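(* For every pair of integers $k,h\geq 1$ there exist polynomials $p_{k,h}(t)$, $q_{k,h}(t)$, $z_{k,h}(t)\in\mathbb{Z}[t]$ with the following property: for every matroid $\mathsf{M}$ of rank $k$ having a stressed hyperplane $H$ with $|H|=h$, if $\widetilde{\mathsf{M}}$ denotes the relaxation of $\mathsf{M}$ at $H$, then \[ P_{\widetilde{\mathsf{M}}}(t) = P_{\mathsf{M}}(t)+p_{k,h}(t),\quad Q_{\widetilde{\mathsf{M}}}(t) = Q_{\mathsf{M}}(t)+q_{k,h}(t),\quad Z_{\widetilde{\mathsf{M}}}(t) = Z_{\mathsf{M}}(t)+z_{k,h}(t).\]
   Context: A hyperplane of a matroid $\mathsf{M}$ of rank $k$ is a flat of rank $k-1$; it is stressed if all its subsets of cardinality $k$ are circuits. If $\mathsf{M}=(E,\mathscr{B})$ has a stressed hyperplane $H$, the relaxation of $\mathsf{M}$ at $H$ is the matroid $\widetilde{\mathsf{M}}=(E,\mathscr{B}\sqcup\{S\subseteq H:|S|=k\})$ (this is a matroid). For a matroid $\mathsf{M}$ on $E$ with lattice of flats $\mathscr{L}(\mathsf{M})$ and a flat $F$: $\mathsf{M}^F$ is the localization (the matroid on $F$ whose flats are the flats of $\mathsf{M}$ contained in $F$) and $\mathsf{M}_F$ is the contraction (the matroid on $E\smallsetminus F$ whose flats are the sets $F'\smallsetminus F$ for flats $F'\supseteq F$). $\chi_{\mathsf{M}}(t)$ is the characteristic polynomial of $\mathsf{M}$. The Kazhdan–Lusztig polynomial $P_{\mathsf{M}}(t)\in\mathbb{Z}[t]$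 is the unique assignment such that: if $\operatorname{rk}(\mathsf{M})=0$ then $P_{\mathsf{M}}=1$ if the ground set is empty and $P_{\mathsf{M}}=0$ otherwise; if $\operatorname{rk}(\mathsf{M})>0$ then $\deg P_{\mathsf{M}}<\operatorname{rk}(\mathsf{M})/2$; and $t^{\operatorname{rk}(\mathsf{M})}P_{\mathsf{M}}(t^{-1})=\sum_{F\in\mathscr{L}(\mathsf{M})}\chi_{\mathsf{M}^F}(t)P_{\mathsf{M}_F}(t)$. The inverse Kazhdan–Lusztig polynomial $Q_{\mathsf{M}}(t)$ is the unique assignment satisfying the same first two conditions and $(-t)^{\operatorname{rk}(\mathsf{M})}Q_{\mathsf{M}}(t^{-1})=\sum_{F\in\mathscr{L}(\mathsf{M})}(-1)^{\operatorname{rk}(F)}Q_{\mathsf{M}^F}(t)\,t^{\operatorname{rk}(\mathsf{M})-\operatorname{rk}(F)}\chi_{\mathsf{M}_F}(t^{-1})$. The $Z$-polynomial is $Z_{\mathsf{M}}(t)=\sum_{F\in\mathscr{L}(\mathsf{M})}t^{\operatorname{rk}(F)}P_{\mathsf{M}_F}(t)$. *)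

(* Defs.v *)
From HB Require Import structures.
From mathcomp Require Import all_boot all_order all_algebra.
From mathcomp Require Import zify.

Set Implicit Arguments.
Unset Strict Implicit.
Unset Printing Implicit Defensive.

Import GRing.Theory.

Section MatroidDef.
Context {T : finType}.
Implicit Types (A B F I J : {set T}).

Definition base_exchange (bs : {set {set T}}) : bool :=
  [forall B1 in bs, forall B2 in bs, forall x in B1 :\: B2,
     exists y in B2 :\: B1, (y |: B1 :\ x) \in bs].

Definition is_matroid (EB : {set T} * {set {set T}}) : bool :=
  [&& EB.2 != set0, [forall B in EB.2, B \subset EB.1] & base_exchange EB.2].

End MatroidDef.

(* A matroid is a pair (E, B) whose ground set E may be any subset of T, so that
   minors live on the same type; the axioms are boolean, which makes
   [matroid T] a finite type. *)
Record matroid (T : finType) :=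
  Matroid { mpair : {set T} * {set {set T}}; _ : is_matroid mpair }.
HB.instance Definition _ (T : finType) := [isSub for @mpair T].
HB.instance Definition _ (T : finType) := [Finite of matroid T by <:].

Definition ground (T : finType) (M : matroid T) : {set T} := (mpair M).1.
Definition bases (T : finType) (M : matroid T) : {set {set T}} := (mpair M).2.

Section MatroidNotions.
Context {T : finType}.
Implicit Types (M : matroid T) (A B C F H I J S : {set T}).

Definition indep M I : bool := [exists B in bases M, I \subset B].

Definition circuit M C : bool :=
  [&& C \subset ground M, ~~ indep M C &
      [forall I : {set T}, (I \proper C) ==> indep M I]].

(* Equals the size of a largest independent subset of A. *)
Definition rk M A : nat := \max_(B in bases M) #|B :&: A|.

Definition rank M : nat := rk M (ground M).

Definition flat M F : bool :=
  (F \subset ground M) &&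
  [forall x in ground M :\: F, rk M F < rk M (x |: F)].

Definition hyperplane M H : bool := flat M H && ((rk M H).+1 == rank M).

Definition stressed_hyperplane M H : bool :=
  hyperplane M H &&
  [forall S : {set T}, (S \subset H) && (#|S| == rank M) ==> circuit M S].

End MatroidNotions.

Lemma eq_matroid (T : finType) (M N : matroid T) :
  ground M = ground N -> bases M = bases N -> M = N.
Proof.
rewrite /ground /bases => e1 e2; apply: val_inj => /=.
by move: e1 e2; case: (mpair M) (mpair N) => ? ? [? ?] /= -> ->.
Qed.

Section BasicTheory.
Context {T : finType}.
Implicit Types (M : matroid T) (A B C F H I J S : {set T}).

Lemma matroid_axiom M :
  [&& bases M != set0, [forall B in bases M, B \subset ground M]
    & base_exchange (bases M)].
Proof. by rewrite /bases /ground; case: M => -[]. Qed.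

Lemma bases_ex M : exists B, B \in bases M.
Proof. by case/and3P: (matroid_axiom M) => /set0Pn. Qed.

Lemma bases_sub M B : B \in bases M -> B \subset ground M.
Proof. by case/and3P: (matroid_axiom M) => _ /forall_inP h _; apply: h. Qed.

Lemma bases_exch M B1 B2 x : B1 \in bases M -> B2 \in bases M ->
  x \in B1 -> x \notin B2 ->
  exists y, [/\ y \in B2, y \notin B1 & (y |: B1 :\ x) \in bases M].
Proof.
case/and3P: (matroid_axiom M) => _ _ /forall_inP h h1 h2 x1 x2.
have xD : x \in B1 :\: B2 by rewrite inE x1 x2.
move/forall_inP: (h _ h1) => /(_ _ h2) /forall_inP /(_ _ xD) /exists_inP[y].
by rewrite inE => /andP[y1 y2] h3; exists y.
Qed.

Lemma bases_card_le M B1 B2 : B1 \in bases M -> B2 \in bases M -> #|B1| <= #|B2|.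
Proof.
have [n] := ubnP #|B1 :\: B2|; elim: n B1 => // n IH B1 ltn h1 h2.
have [/eqP|[x]] := set_0Vmem (B1 :\: B2).
  by rewrite setD_eq0 => /subset_leq_card.
rewrite inE => /andP[x2 x1].
have [y [y2 y1 h3]] := bases_exch h1 h2 x1 x2.
have -> : #|B1| = #|y |: B1 :\ x|.
  by rewrite cardsU1 !inE negb_and y1 orbT (cardsD1 x B1) x1.
apply: IH => //; rewrite ltnS in ltn; apply: leq_trans ltn; apply: proper_card.
apply/properP; split; last by exists x; rewrite !inE ?x1 ?x2 // eqxx /= orbF;
  case: eqP => //= e; rewrite e y2 in x2.
by apply/subsetP=> z; rewrite !inE; case: eqP => [->|_] /=; [rewrite y2|];
  case: (z \in B2) => //= /andP[].
Qed.

Lemma bases_card M B1 B2 : B1 \in bases M -> B2 \in bases M -> #|B1| = #|B2|.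
Proof. by move=> h1 h2; apply/eqP; rewrite eqn_leq !(@bases_card_le M). Qed.

Lemma indepP M I : reflect (exists2 B, B \in bases M & I \subset B) (indep M I).
Proof. exact: exists_inP. Qed.

Lemma indep_sub M I J : indep M J -> I \subset J -> indep M I.
Proof. by case/indepP=> B hB JB IJ; apply/indepP; exists B => //; apply: subset_trans JB. Qed.

Lemma indep_ground M I : indep M I -> I \subset ground M.
Proof. by case/indepP=> B /bases_sub h IB; apply: subset_trans h. Qed.

Lemma indep_aug M I J : indep M I -> indep M J -> #|I| < #|J| ->
  exists x, [/\ x \in J, x \notin I & indep M (x |: I)].
Proof.
move=> /indepP[B1 h1 IB] /indepP[B2' h2' JB2'] ltIJ.
have [B2 [h2 JB2 B2D]] : exists B2, [/\ B2 \in bases M, J \subset B2 & B2 :\: B1 \subset J].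
  have [n] := ubnP #|B2' :\: (J :|: B1)|; elim: n B2' h2' JB2' => // n IH B2 h2 JB2 ltn.
  have [/eqP|[x]] := set_0Vmem (B2 :\: (J :|: B1)).
    rewrite setD_eq0 => h; exists B2; split=> //; apply/subsetP=> z.
    by rewrite inE => /andP[z1 z2]; move/subsetP: h => /(_ _ z2); rewrite inE (negPf z1) orbF.
  rewrite !inE negb_or -andbA => /and3P[xJ x1 x2].
  have [y [y1 y2 h3]] := bases_exch h2 h1 x2 x1.
  apply: (IH _ h3).
    apply/subsetP=> z zJ; rewrite !inE (subsetP JB2 _ zJ) andbT.
    by rewrite orbC; case: eqP => // e; rewrite -e zJ in xJ.
  rewrite ltnS in ltn; apply: leq_trans ltn; apply: proper_card; apply/properP; split; last first.
    exists x; rewrite !inE ?(negPf xJ) ?(negPf x1) ?x2 //= eqxx /= orbF.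
    by case: eqP => // e; rewrite e y1 in x1.
  apply/subsetP=> z; rewrite !inE; case: eqP => [->|_] /=; first by rewrite y1 orbT.
  by case/andP=> -> /andP[].
have [B1' [h1' IB1' [B1D|[y yJ]]]] : exists B1', [/\ B1' \in bases M, I \subset B1' &
     ((B1' :\: B2 \subset I) /\ (B2 :\: B1' \subset J)) \/ exists2 y, y \in J & (y \notin I) /\ indep M (y |: I)].
  have [/eqP|[x]] := set_0Vmem (B1 :\: (I :|: B2)).
    rewrite setD_eq0 => h; exists B1; split=> //; left; split=> //; apply/subsetP=> z.
    by rewrite inE => /andP[z1 z2]; move/subsetP: h => /(_ _ z2); rewrite inE (negPf z1) orbF.
  rewrite !inE negb_or -andbA => /and3P[xI x2 x1].
  have [y [y2 y1 h3]] := bases_exch h1 h2 x1 x2.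
  exists B1; split=> //; right; exists y.
    by apply: (subsetP B2D); rewrite inE y1 y2.
  split; first by apply: contra y1; apply: (subsetP IB).
  apply/indepP; exists (y |: B1 :\ x) => //; apply: setUS; apply/subsetP=> z zI.
  by rewrite !inE (subsetP IB _ zI) andbT; case: eqP => // e; rewrite -e zI in xI.
- case: B1D => B1D B2D'.
  have [|[x]] := set_0Vmem ((J :&: B1') :\: I); last first.
    rewrite !inE => /and3P[xI xJ x1]; exists x; split=> //.
    by apply/indepP; exists B1' => //; rewrite subUset sub1set x1.
  move/eqP; rewrite setD_eq0 => JI; exfalso.
  have e := bases_card h1' h2.
  have := cardsID B2 B1'; have := cardsID B1' B2; rewrite setIC e => <- eD.
  have := cardsID B1' J; have := cardsID B2 I => eI eJ.
  have l1 : #|J :&: B1'| <= #|I :&: B2|.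
    apply/subset_leq_card/subsetP=> z zz; rewrite inE (subsetP JI _ zz).
    by apply: (subsetP JB2); move: zz; rewrite inE => /andP[].
  have l2 : #|J :\: B1'| <= #|B2 :\: B1'| by apply/subset_leq_card/setSD.
  have l3 : #|B1' :\: B2| <= #|I :\: B2|.
    apply/subset_leq_card/subsetP=> z zz; rewrite inE (subsetP B1D _ zz) andbT.
    by move: zz; rewrite inE => /andP[].
  by lia.
- by case=> yI h; exists y.
Qed.

Lemma rk_ge M A B : B \in bases M -> #|B :&: A| <= rk M A.
Proof.
exact: (@leq_bigmax_cond _ (fun B => B \in bases M) (fun B => #|B :&: A|)).
Qed.

Lemma indep_rk M I A : indep M I -> I \subset A -> #|I| <= rk M A.
Proof.
case/indepP=> B hB IB IA; apply: leq_trans (rk_ge A hB).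
by apply: subset_leq_card; rewrite subsetI IB.
Qed.

Lemma rk_ex M A : exists I, [/\ indep M I, I \subset A & #|I| = rk M A].
Proof.
have [B0 hB0] := bases_ex M.
have h : 0 < #|bases M| by apply/card_gt0P; exists B0.
have [B hB e] := eq_bigmax_cond (fun B : {set T} => #|B :&: A|) h.
exists (B :&: A); split; [|exact: subsetIr|by rewrite -e].
by apply/indepP; exists B => //; apply: subsetIl.
Qed.

Lemma indep_ext M I A : indep M I -> I \subset A ->
  exists J, [/\ indep M J, I \subset J, J \subset A & #|J| = rk M A].
Proof.
have [K [hK KA eK]] := rk_ex M A.
have [n] := ubnP (rk M A - #|I|); elim: n I => // n IH I ltn hI IA.
have := indep_rk hI IA; rewrite leq_eqVlt => /orP[/eqP e|lt].
  by exists I.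
have [x [xK xI hx]] := indep_aug hI hK (leq_trans lt (eq_leq (esym eK))).
have [||J [hJ IJ JA eJ]] := IH (x |: I) _ hx.
- by rewrite cardsU1 xI /=; lia.
- by rewrite subUset sub1set (subsetP KA).
by exists J; split=> //; apply: subset_trans IJ; apply: subsetUr.
Qed.

Lemma rk_card M A : rk M A <= #|A|.
Proof. by have [I [_ /subset_leq_card IA <-]] := rk_ex M A. Qed.

Lemma rkS M A B : A \subset B -> rk M A <= rk M B.
Proof.
by move=> AB; have [I [hI IA <-]] := rk_ex M A; apply: indep_rk => //; apply: subset_trans AB.
Qed.

Lemma rk_submod M A B : rk M (A :|: B) + rk M (A :&: B) <= rk M A + rk M B.
Proof.
have [I [hI IA eI]] := rk_ex M (A :&: B).
have [J [hJ IJ JA eJ]] := indep_ext hI (subset_trans IA (subset_trans (subsetIl A B) (subsetUl A B))).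
have l1 : #|J :&: A| <= rk M A by apply: indep_rk; [apply: indep_sub hJ _; apply: subsetIl|apply: subsetIr].
have l2 : #|J :&: B| <= rk M B by apply: indep_rk; [apply: indep_sub hJ _; apply: subsetIl|apply: subsetIr].
have l3 : #|I| <= #|J :&: A :&: (J :&: B)|.
  apply: subset_leq_card; apply/subsetP=> x xI; rewrite !inE (subsetP IJ _ xI) /=.
  by move: (subsetP IA _ xI); rewrite inE.
have := cardsUI (J :&: A) (J :&: B); rewrite -setIUr (setIidPl JA).
lia.
Qed.

Lemma rkIg M A : rk M (A :&: ground M) = rk M A.
Proof.
apply/eqP; rewrite eqn_leq rkS ?subsetIl //=.
have [I [hI IA <-]] := rk_ex M A; apply: indep_rk => //.
by rewrite subsetI IA indep_ground.
Qed.

Lemma indepE M I : indep M I = (#|I| == rk M I).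
Proof.
apply/idP/eqP=> [hI|e]; first by apply/eqP; rewrite eqn_leq rk_card andbT indep_rk.
have [J [hJ JI eJ]] := rk_ex M I.
have /eqP <- // : J == I by rewrite eqEcard JI eJ e leqnn.
Qed.

Lemma basesE M B : (B \in bases M) = [&& B \subset ground M, indep M B & #|B| == rank M].
Proof.
apply/idP/and3P=> [hB|[_ /indepP[B' hB' BB'] /eqP e]].
  have iB : indep M B by apply/indepP; exists B.
  split; [exact: bases_sub|by []|].
  rewrite eqn_leq indep_rk ?bases_sub //= /rank.
  have [J [/indepP[B' hB' JB'] _ <-]] := rk_ex M (ground M).
  by rewrite (bases_card hB hB') subset_leq_card.
have /eqP -> // : B == B'.
rewrite eqEcard BB' e /rank; apply: indep_rk; last exact: bases_sub.
by apply/indepP; exists B'.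
Qed.

End BasicTheory.

Section OfRank.
Context {T : finType}.
Variables (E : {set T}) (r : {set T} -> nat).
Implicit Types (A B I J : {set T}).
Hypothesis r_card : forall A, r A <= #|A|.
Hypothesis rS : forall A B, A \subset B -> r A <= r B.
Hypothesis r_submod : forall A B, r (A :|: B) + r (A :&: B) <= r A + r B.

Definition rank_bases : {set {set T}} :=
  [set I : {set T} | [&& I \subset E, #|I| == r I & r I == r E]].

Lemma r_add A (S : {set T}) : (forall y, y \in S -> r (y |: A) = r A) -> r (A :|: S) = r A.
Proof.
have [n] := ubnP #|S|; elim: n S => // n IH S ltn h.
have [->|[y yS]] := set_0Vmem S; first by rewrite setU0.
have e : r (A :|: (S :\ y)) = r A.
  apply: IH => [|z]; first by move: ltn; rewrite (cardsD1 y) yS; lia.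
  by rewrite inE => /andP[_ /h].
have := r_submod (A :|: (S :\ y)) (y |: A); rewrite e (h _ yS).
have -> : A :|: S :\ y :|: (y |: A) = A :|: S.
  by apply/setP=> z; rewrite !inE; case: eqP => [->|_] /=; [rewrite yS !orbT|];
    case: (z \in A); rewrite ?orbT ?orbF.
have l1 : r A <= r ((A :|: S :\ y) :&: (y |: A)).
  by apply: rS; rewrite subsetI subsetUl subsetUr.
have l2 : r A <= r (A :|: S) by apply: rS; apply: subsetUl.
lia.
Qed.

Lemma r_sub I J : #|J| = r J -> I \subset J -> #|I| = r I.
Proof.
move=> e IJ; have := r_submod I (J :\: I); have := r_card I; have := r_card (J :\: I).
have -> : I :|: (J :\: I) = J by rewrite setUC setDE setUIl [~: I :|: I]setUC setUCr setIT; apply/setUidPl.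
by have := cardsID I J; rewrite (setIidPr IJ); lia.
Qed.

Lemma r_ext I A : #|I| = r I -> I \subset A ->
  exists J, [/\ #|J| = r J, I \subset J, J \subset A & r J = r A].
Proof.
have [n] := ubnP (#|A| - #|I|); elim: n I => // n IH I ltn hI IA.
have [/existsP[y /andP[yA]]|] := boolP [exists y, (y \in A) && (r (y |: I) != r I)].
  move=> ne.
  have yI : y \notin I.
    by apply: contra ne => yI; rewrite (setUidPr _) // sub1set.
  have l1 : r I <= r (y |: I) by apply: rS; apply: subsetUr.
  have l2 := r_card (y |: I); have c : #|y |: I| = #|I|.+1 by rewrite cardsU1 yI.
  have yIA : y |: I \subset A by rewrite subUset sub1set yA.
  have [|||J [a b c' d]] := IH (y |: I).
  - by have := subset_leq_card yIA; lia.
  - by move/eqP: ne; lia.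
  - by [].
  by exists J; split=> //; apply: subset_trans b; apply: subsetUr.
rewrite negb_exists => /forallP h; exists I; split=> //.
rewrite -[in RHS](setUidPr IA); apply/esym/r_add => y yA.
by move: (h y); rewrite yA /= negbK => /eqP.
Qed.

Lemma r0 : r set0 = 0.
Proof. by apply/eqP; rewrite -leqn0 -(cards0 T). Qed.

Lemma rank_is_matroid : is_matroid (E, rank_bases).
Proof.
apply/and3P; split=> /=.
- have [||J [a b c d]] := @r_ext set0 E; rewrite ?cards0 ?r0 ?sub0set //.
  by apply/set0Pn; exists J; rewrite inE a c d !eqxx.
- by apply/forall_inP=> B; rewrite inE => /andP[].
apply/forall_inP=> B1; rewrite inE => /and3P[s1 /eqP c1 /eqP r1].
apply/forall_inP=> B2; rewrite inE => /and3P[s2 /eqP c2 /eqP r2].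
apply/forall_inP=> x; rewrite inE => /andP[x2 x1].
have c0 : #|B1 :\ x| = r (B1 :\ x) by apply: (r_sub c1); apply: subsetDl.
have [/existsP[y /andP[yA ne]]|] := boolP [exists y, (y \in B2) && (r (y |: B1 :\ x) != r (B1 :\ x))].
  have yx : y != x by apply: contraNneq x2 => <-.
  have y1 : y \notin B1.
    by apply: contra ne => y1; rewrite (setUidPr _) // sub1set !inE yx.
  apply/exists_inP; exists y; first by rewrite inE y1 yA.
  have l1 : r (B1 :\ x) <= r (y |: B1 :\ x) by apply: rS; apply: subsetUr.
  have l2 := r_card (y |: B1 :\ x); have c : #|y |: B1 :\ x| = #|B1 :\ x|.+1.
    by rewrite cardsU1 !inE negb_and y1 orbT.
  have c' : #|B1| = #|B1 :\ x|.+1 by rewrite (cardsD1 x) x1.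
  rewrite inE subUset sub1set (subsetP s2 _ yA) (subset_trans (subsetDl _ _) s1) /=.
  by move/eqP: ne => ne; apply/andP; split; apply/eqP; lia.
rewrite negb_exists => /forallP h; exfalso.
have e : r (B1 :\ x :|: B2) = r (B1 :\ x).
  by apply: r_add => y yA; move: (h y); rewrite yA /= negbK => /eqP.
have l : r B2 <= r (B1 :\ x :|: B2) by apply: rS; apply: subsetUr.
have c' : #|B1| = #|B1 :\ x|.+1 by rewrite (cardsD1 x) x1.
lia.
Qed.

Lemma rk_rank_bases (M : matroid T) A :
  bases M = rank_bases -> A \subset E -> rk M A = r A.
Proof.
move=> eM AE; apply/eqP; rewrite eqn_leq; apply/andP; split.
  apply/bigmax_leqP=> B; rewrite eM inE => /and3P[_ /eqP c _].
  by rewrite (r_sub c) ?subsetIl // rS ?subsetIr.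
have [||I [a _ c d]] := @r_ext set0 A; rewrite ?cards0 ?r0 ?sub0set //.
have [J [a' b' c' d']] := r_ext a (subset_trans c AE).
have hJ : J \in bases M by rewrite eM inE c' a' d' !eqxx.
apply: leq_trans (rk_ge A hJ).
by rewrite -d -a; apply: subset_leq_card; rewrite subsetI b'.
Qed.

End OfRank.

Section Minors.
Context {T : finType}.
Implicit Types (M N : matroid T) (A B C F G H I J S : {set T}).

Lemma eq_matroid_rk M N : ground M = ground N ->
  (forall A, A \subset ground M -> rk M A = rk N A) -> M = N.
Proof.
move=> eg er; apply: eq_matroid => //; apply/setP=> B; rewrite !basesE !indepE -eg.
have [s|] //= := boolP (B \subset ground M).
by rewrite (er _ s) /rank (er (ground M)) ?eg.
Qed.

Definition localization_sets M F : {set T} * {set {set T}} :=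
  (F, [set I : {set T} | [&& I \subset F, indep M I & #|I| == rk M F]]).

Fact localization_is_matroid M F : is_matroid (localization_sets M F).
Proof.
have := rank_is_matroid F (rk_card M) (@rkS _ M) (rk_submod M).
congr (is_matroid (_, _)); apply/setP=> I; rewrite !inE indepE.
by case: eqP => [->|] //=.
Qed.

(* The restriction M|F. For a flat F its flats are those of M inside F, see
   [flat_localization]. *)
Definition localization M F : matroid T := Matroid (localization_is_matroid M F).

Definition contraction_sets M F : {set T} * {set {set T}} :=
  (ground M :\: F,
   [set I : {set T} | [&& I \subset ground M :\: F, #|I| + rk M F == rank M
                        & rk M (I :|: F) == rank M]]).

Let r M F A := rk M (A :|: F) - rk M F.

Let r_card M F A : r M F A <= #|A|.
Proof. by rewrite /r; have := rk_submod M A F; have := rk_card M A; lia. Qed.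

Let rS M F A B : A \subset B -> r M F A <= r M F B.
Proof. by move=> AB; rewrite /r leq_sub2r // rkS // setSU. Qed.

Let r_submod M F A B : r M F (A :|: B) + r M F (A :&: B) <= r M F A + r M F B.
Proof.
rewrite /r; have := rk_submod M (A :|: F) (B :|: F).
have -> : A :|: F :|: (B :|: F) = A :|: B :|: F by rewrite setUACA setUid.
rewrite -setUIl.
have l X : rk M F <= rk M (X :|: F) by rewrite rkS // subsetUr.
by have := l A; have := l B; have := l (A :|: B); have := l (A :&: B); lia.
Qed.

Let rk_groundU M F : rk M (ground M :\: F :|: F) = rank M.
Proof.
rewrite -rkIg; congr rk; apply/setP=> z; rewrite !inE.
by case: (z \in F); case: (z \in ground M).
Qed.

Lemma rk_le_rank M A : rk M A <= rank M.
Proof. by rewrite -rkIg rkS // subsetIr. Qed.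

Let contraction_bases M F :
  (contraction_sets M F).2 = rank_bases (ground M :\: F) (r M F).
Proof.
apply/setP=> I; rewrite !inE /r rk_groundU.
have := rk_le_rank M F; have := @rkS _ M F (I :|: F) (subsetUr _ _).
have := rk_le_rank M (I :|: F).
by case: (_ \subset _) => //= l1 l2 l3; apply/andP/andP=> -[/eqP e1 /eqP e2];
  split; apply/eqP; lia.
Qed.

Fact contraction_is_matroid M F : is_matroid (contraction_sets M F).
Proof.
have := rank_is_matroid (ground M :\: F) (@r_card M F) (@rS M F) (@r_submod M F).
by rewrite -contraction_bases.
Qed.

(* M/F; its flats are the F' :\: F for F' a flat of M containing F, see
   [flat_contraction]. *)
Definition contraction M F : matroid T := Matroid (contraction_is_matroid M F).

Lemma rk_localization M F A : A \subset F -> rk (localization M F) A = rk M A.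
Proof.
apply: (rk_rank_bases (rk_card M) (@rkS _ M) (rk_submod M)).
by apply/setP=> I; rewrite !inE indepE; case: eqP => [->|] //=.
Qed.

Lemma rk_contraction M F A : A \subset ground M :\: F ->
  rk (contraction M F) A = rk M (A :|: F) - rk M F.
Proof.
apply: (rk_rank_bases (@r_card M F) (@rS M F) (@r_submod M F)).
exact: contraction_bases.
Qed.

Lemma ground_localization M F : ground (localization M F) = F. Proof. by []. Qed.
Lemma ground_contraction M F : ground (contraction M F) = ground M :\: F.
Proof. by []. Qed.

Lemma rank_localization M F : rank (localization M F) = rk M F.
Proof. exact: rk_localization. Qed.

Lemma rank_contraction M F : rank (contraction M F) = rank M - rk M F.
Proof. by rewrite /rank rk_contraction // rk_groundU. Qed.

Lemma flatP M F : reflect (F \subset ground M /\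
    forall x, x \in ground M -> x \notin F -> rk M F < rk M (x |: F)) (flat M F).
Proof.
apply: (iffP andP) => -[s h]; split=> //.
  by move=> x xg xF; move/forall_inP: h; apply; rewrite inE xF.
by apply/forall_inP=> x; rewrite inE => /andP[xF xg]; apply: h.
Qed.

Lemma flat_sub M F : flat M F -> F \subset ground M. Proof. by case/andP. Qed.

Lemma flat_ground M : flat M (ground M).
Proof. by apply/flatP; split=> // x ->. Qed.

Lemma flat_localization M F G : flat M F ->
  flat (localization M F) G = flat M G && (G \subset F).
Proof.
move=> /flatP[sF hF]; apply/flatP/andP=> [[s h]|[/flatP[s h] GF]]; last first.
  split=> // x xF xG; rewrite !rk_localization ?subUset ?sub1set ?xF //.
  by apply: h => //; apply: (subsetP sF).
rewrite /= ground_localization in s h; split=> //; apply/flatP; split.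
  exact: subset_trans sF.
move=> x xg xG; have [xF|xF] := boolP (x \in F).
  by have := h _ xF xG; rewrite !rk_localization ?subUset ?sub1set ?xF.
have := hF _ xg xF; have := rk_submod M (x |: G) F.
have -> : x |: G :|: F = x |: F by rewrite -setUA (setUidPr s).
have : rk M G <= rk M ((x |: G) :&: F) by rewrite rkS // subsetI subsetUr.
lia.
Qed.

Lemma flat_contraction M F G : F \subset ground M -> G \subset ground M :\: F ->
  flat (contraction M F) G = flat M (G :|: F).
Proof.
move=> sF sG; have sGg : G \subset ground M by apply: subset_trans sG (subsetDl _ _).
have l A : rk M F <= rk M (A :|: F) by rewrite rkS // subsetUr.
apply/flatP/flatP=> -[s h]; split=> //; rewrite ?subUset ?sGg //.
  move=> x xg; rewrite inE negb_or => /andP[xG xF].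
  have xD : x \in ground M :\: F by rewrite inE xF.
  have := h _ xD xG; rewrite !rk_contraction ?subUset ?sub1set ?xD // setUA.
  by have := l G; have := l (x |: G); lia.
move=> x xD xG; have := xD; rewrite inE => /andP[xF xg].
rewrite !rk_contraction ?subUset ?sub1set ?xD //.
have := h x xg; rewrite inE negb_or xG xF => /(_ isT).
by have := l G; have := l (x |: G); rewrite setUA; lia.
Qed.

Lemma contraction0 M : contraction M set0 = M.
Proof.
have r0M : rk M set0 = 0 by apply/eqP; rewrite -leqn0 -(cards0 T) rk_card.
apply: eq_matroid_rk => [|A sA]; first by rewrite ground_contraction setD0.
by rewrite rk_contraction // setU0 r0M subn0.
Qed.

Lemma localizationT M : localization M (ground M) = M.
Proof. by apply: eq_matroid_rk => // A sA; rewrite rk_localization. Qed.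

Lemma localizationK M F G : F \subset G ->
  localization (localization M G) F = localization M F.
Proof.
move=> FG; apply: eq_matroid_rk => // A sA.
by rewrite !rk_localization // (subset_trans sA).
Qed.

Lemma localization_contraction M F G : F \subset G -> G \subset ground M ->
  localization (contraction M F) (G :\: F) = contraction (localization M G) F.
Proof.
move=> FG sG; apply: eq_matroid_rk => // A sA.
rewrite ground_localization in sA.
have sAg : A \subset ground M :\: F by apply: subset_trans sA _; apply: setSD.
have AG : A \subset G by apply: subset_trans sA _; apply: subsetDl.
rewrite rk_localization // !rk_contraction // !rk_localization //.
by rewrite subUset AG.
Qed.

Lemma contractionK M F G : F \subset G -> G \subset ground M ->
  contraction (contraction M F) (G :\: F) = contraction M G.
Proof.
move=> FG sG.
have e : ground M :\: F :\: (G :\: F) = ground M :\: G.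
  apply/setP=> z; rewrite !inE; case: (boolP (z \in F)) => [/(subsetP FG) ->|] //=.
apply: eq_matroid_rk => [|A sA]; first by rewrite !ground_contraction.
rewrite !ground_contraction e in sA.
have sAF : A \subset ground M :\: F by apply: subset_trans sA _; apply: setDS.
rewrite !rk_contraction ?ground_contraction ?e ?subUset ?sAF ?setSD //.
have -> : G :\: F :|: F = G.
  apply/setP=> z; rewrite !inE; case: (boolP (z \in F)) => [/(subsetP FG) ->|] //=.
  by rewrite orbF.
have -> : A :|: G :\: F :|: F = A :|: G.
  apply/setP=> z; rewrite !inE; case: (boolP (z \in F)) => [/(subsetP FG) ->|] //=.
    by rewrite !orbT.
  by rewrite orbF.
have := @rkS _ M _ _ FG; have := @rkS _ M G (A :|: G) (subsetUr _ _).
lia.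
Qed.

End Minors.

Section Relaxation.
Context {T : finType}.
Implicit Types (M : matroid T) (H S B A : {set T}).

Definition relaxation_sets M H : {set T} * {set {set T}} :=
  (ground M, bases M :|: [set S : {set T} | S \subset H & #|S| == rank M]).

Fact relaxation_is_matroid M H :
  stressed_hyperplane M H -> is_matroid (relaxation_sets M H).
Proof.
move=> /andP[/andP[/flatP[sH hH] /eqP rH] /forallP st].
have cS S : S \subset H -> #|S| = rank M ->
    forall x, x \in S -> indep M (S :\ x) /\ rk M (S :\ x) = rk M H.
  move=> SH cS x xS.
  have := st S; rewrite SH cS eqxx => /and3P[_ _ /forallP /(_ (S :\ x))].
  rewrite properD1 //= => h; split=> //; move: h; rewrite indepE => /eqP <-.
  by move: cS; rewrite (cardsD1 x) xS; lia.
have up A y : A \subset H -> rk M A = rk M H -> y \in ground M -> y \notin H ->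
    rank M <= rk M (y |: A).
  move=> AH rA yg yH; have := rk_submod M H (y |: A); have := hH _ yg yH.
  have -> : H :|: (y |: A) = y |: H by rewrite setUCA (setUidPl AH).
  have : rk M A <= rk M (H :&: (y |: A)) by rewrite rkS // subsetI AH subsetUr.
  lia.
apply/and3P; split=> /=.
- by have [B hB] := bases_ex M; apply/set0Pn; exists B; rewrite inE hB.
- apply/forall_inP=> B; rewrite !inE => /orP[/bases_sub //|/andP[BH _]].
  exact: subset_trans sH.
apply/forall_inP=> B1 h1; apply/forall_inP=> B2 h2; apply/forall_inP=> x.
rewrite inE => /andP[x2 x1].
have c B : B \in bases M :|: [set S : {set T} | S \subset H & #|S| == rank M] -> #|B| = rank M.
  rewrite !inE => /orP[|/andP[_ /eqP //]].
  by rewrite basesE => /and3P[_ _ /eqP].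
have c1 := c _ h1; have c2 := c _ h2.
have cx : #|B1 :\ x|.+1 = rank M by rewrite -c1 (cardsD1 x B1) x1.
have cy y : y \notin B1 -> #|y |: B1 :\ x| = rank M.
  by move=> y1; rewrite cardsU1 !inE negb_and y1 orbT -cx.
have inB y : y \in ground M -> y \notin B1 -> B1 :\ x \subset ground M ->
    rank M <= rk M (y |: B1 :\ x) -> y |: B1 :\ x \in bases M.
  move=> yg y1 sB l; rewrite basesE indepE cy // subUset sub1set yg sB /= eqxx andbT.
  by rewrite eqn_leq l rk_le_rank.
move: h1 h2; rewrite !inE => /orP[b1|/andP[s1 _]] /orP[b2|/andP[s2 _]].
- have [y [y2 y1 h]] := bases_exch b1 b2 x1 x2.
  by apply/exists_inP; exists y; rewrite !inE ?y1 ?y2 ?h.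
- have [sB1|nB1] := boolP (B1 :\ x \subset H).
    have [y y2 y1] : exists2 y, y \in B2 & y \notin B1.
      have : ~~ (B2 \subset B1).
        apply/negP=> s; have /eqP e : B2 == B1 by rewrite eqEcard s c1 c2 leqnn.
        by rewrite e x1 in x2.
      by case/subsetPn=> y; exists y.
    apply/exists_inP; exists y; first by rewrite !inE y1.
    by rewrite !inE subUset sub1set (subsetP s2 _ y2) sB1 cy // eqxx orbT.
  have sg := bases_sub b1.
  have iB : rk M (B1 :\ x) = #|B1 :\ x|.
    have : indep M (B1 :\ x) by apply/indepP; exists B1 => //; apply: subsetDl.
    by rewrite indepE => /eqP.
  have [/existsP[y /andP[yA ne]]|] :=
      boolP [exists y, (y \in B2) && (rk M (y |: B1 :\ x) != rk M (B1 :\ x))].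
    have yx : y != x by apply: contraNneq x2 => <-.
    have y1 : y \notin B1.
      by apply: contra ne => y1; rewrite (setUidPr _) // sub1set !inE yx.
    apply/exists_inP; exists y; first by rewrite !inE y1.
    rewrite !inE (inB y) // ?(subsetP sH) ?(subsetP s2) //.
      by apply: subset_trans sg; apply: subsetDl.
    have : rk M (B1 :\ x) <= rk M (y |: B1 :\ x) by rewrite rkS // subsetUr.
    by move/eqP: ne; lia.
  rewrite negb_exists => /forallP h; exfalso.
  have e : rk M (B1 :\ x :|: B2) = rk M (B1 :\ x).
    apply: (r_add (@rkS _ M) (rk_submod M)) => y yA.
    by move: (h y); rewrite yA /= negbK => /eqP.
  case/subsetPn: nB1 => a aB aH.
  have ag : a \in ground M by apply: (subsetP sg); move: aB; rewrite inE => /andP[].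
  have [s sB2] : exists s, s \in B2 by apply/set0Pn; rewrite -card_gt0 c2 -rH.
  have [_ rs] := cS _ s2 c2 _ sB2.
  have rB2 : rk M B2 = rk M H.
    by apply/eqP; rewrite eqn_leq rkS //= -rs rkS // subsetDl.
  have := up _ _ s2 rB2 ag aH.
  have : rk M (a |: B2) <= rk M (B1 :\ x :|: B2).
    by rewrite rkS // setSU // sub1set.
  lia.
- have [y y2 yH] : exists2 y, y \in B2 & y \notin H.
    have : ~~ (B2 \subset H).
      apply/negP=> /(@rkS _ M); move: b2; rewrite basesE indepE => /and3P[_ /eqP <- _].
      by rewrite c2; lia.
    by case/subsetPn=> y; exists y.
  have y1 : y \notin B1 by apply: contra yH; apply: (subsetP s1).
  have yg : y \in ground M by apply: (subsetP (bases_sub b2)).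
  have s1x : B1 :\ x \subset H by apply: subset_trans s1; apply: subsetDl.
  apply/exists_inP; exists y; first by rewrite !inE y1.
  rewrite !inE (inB y) //; first exact: subset_trans sH.
  by apply: up => //; case: (cS _ s1 c1 _ x1).
- have [y y2 y1] : exists2 y, y \in B2 & y \notin B1.
    have : ~~ (B2 \subset B1).
      apply/negP=> s; have /eqP e : B2 == B1 by rewrite eqEcard s c1 c2 leqnn.
      by rewrite e x1 in x2.
    by case/subsetPn=> y; exists y.
  apply/exists_inP; exists y; first by rewrite !inE y1.
  rewrite !inE subUset sub1set (subsetP s2 _ y2) cy // eqxx.
  by rewrite (subset_trans (subsetDl _ _) s1) orbT.
Qed.

Definition relaxation M H (sH : stressed_hyperplane M H) : matroid T :=
  Matroid (relaxation_is_matroid sH).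

End Relaxation.

Local Open Scope ring_scope.

(* t^n p(1/t), for p of degree at most n (see [revp_eval]). *)
Definition revp (n : nat) (p : {poly int}) : {poly int} :=
  \poly_(i < n.+1) p`_(n - i).

Section Revp.
Implicit Types (n : nat) (p q : {poly int}).

Lemma coef_revp n p i : (revp n p)`_i = if (i <= n)%N then p`_(n - i) else 0.
Proof. by rewrite coef_poly ltnS. Qed.

Fact revp_is_linear n : linear (revp n).
Proof.
move=> a p q; apply/polyP=> i; rewrite coefD coefZ !coef_revp.
by case: ifP => _; rewrite ?coefD ?coefZ // mulr0 addr0.
Qed.
HB.instance Definition _ n :=
  GRing.isLinear.Build int {poly int} {poly int} _ (revp n) (revp_is_linear n).

Lemma revpXn n i : (i <= n)%N -> revp n 'X^i = 'X^(n - i).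
Proof.
move=> h; apply/polyP=> j; rewrite coef_revp !coefXn.
by case: ifP => hj; [congr (_%:R : int); congr nat_of_bool|]; lia.
Qed.

Lemma size_revp n p : (size (revp n p) <= n.+1)%N.
Proof. exact: size_poly. Qed.

Lemma revpK n p : (size p <= n.+1)%N -> revp n (revp n p) = p.
Proof.
move=> h; apply/polyP=> i; rewrite !coef_revp leq_subr /=.
case: ifP => hi; first by rewrite subKn.
by rewrite nth_default //; apply: leq_trans h _; rewrite ltnNge hi.
Qed.

Lemma poly_sum n p : (size p <= n)%N -> p = \sum_(i < n) p`_i *: 'X^i.
Proof.
move=> h; rewrite -poly_def; apply/polyP=> i; rewrite coef_poly.
by case: ltnP => // hi; rewrite nth_default //; apply: leq_trans h hi.
Qed.

Lemma revpM a b p q : (size p <= a.+1)%N -> (size q <= b.+1)%N ->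
  revp (a + b) (p * q) = revp a p * revp b q.
Proof.
move=> hp hq; rewrite (poly_sum hp) (poly_sum hq) mulr_suml !linear_sum mulr_suml.
apply: eq_bigr => i _; rewrite !mulr_sumr !linear_sum; apply: eq_bigr => j _.
have hi : (i <= a)%N by rewrite -ltnS.
have hj : (j <= b)%N by rewrite -ltnS.
rewrite -scalerAl -scalerAr -exprD !linearZ /= !revpXn ?leq_add //.
rewrite -scalerAl -scalerAr -exprD; congr (_ *: (_ *: 'X^_)); lia.
Qed.

Lemma revp_eval (K : fieldType) n p (x : K) : (size p <= n.+1)%N -> x != 0 ->
  (map_poly intr (revp n p)).[x] = x ^+ n * (map_poly intr p).[x^-1].
Proof.
move=> h x0; rewrite (poly_sum h) linear_sum !rmorph_sum !horner_sum mulr_sumr.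
apply: eq_bigr => i _; rewrite linearZ /= revpXn -1?ltnS //.
rewrite -!mul_polyC !rmorphM /= !map_polyC /= !map_polyXn !hornerM !hornerC !hornerXn.
rewrite mulrCA; congr (_ * _); rewrite exprVn expfB_cond ?(negPf x0) //=.
by rewrite add0n -ltnS.
Qed.

End Revp.

Section CharPoly.
Context {T : finType}.
Implicit Types (M : matroid T) (A B F G : {set T}).

(* With this expansion chi M = 0 as soon as M has a loop ([chi_loop]). This is
   the convention under which the rank 0 clause of [KL_rank0] is compatible with
   [KL_equation]: if rank M = 0, the latter reads P M = chi M. *)
Definition chi M : {poly int} :=
  \sum_(A : {set T} | A \subset ground M) (-1) ^+ #|A| * 'X^(rank M - rk M A).

Lemma size_signXn (a n : nat) : size ((-1) ^+ a * 'X^n : {poly int}) = n.+1.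
Proof. by rewrite -signr_odd mulr_sign; case: odd; rewrite ?size_polyN size_polyXn. Qed.

Lemma size_chi M : (size (chi M) <= (rank M).+1)%N.
Proof.
apply: leq_trans (size_sum _ _ _) _; apply/bigmax_leqP=> A _.
by rewrite size_signXn ltnS leq_subr.
Qed.

Lemma revp_chi M : revp (rank M) (chi M) =
  \sum_(A : {set T} | A \subset ground M) (-1) ^+ #|A| * 'X^(rk M A).
Proof.
rewrite linear_sum /=; apply: eq_bigr => A _.
rewrite -signr_odd !mulr_sign (fun_if (revp _)) linearN /= revpXn ?leq_subr //.
by rewrite subKn // rk_le_rank.
Qed.

Lemma sum_toggle (h : {set T} -> {poly int}) A F x : x \in F -> x \notin A ->
  (forall B, A \subset B -> B \subset F -> x \notin B -> h (x |: B) = h B) ->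
  \sum_(B : {set T} | (A \subset B) && (B \subset F)) (-1) ^+ #|B| * h B = 0.
Proof.
move=> xF xA hh; rewrite (bigID (fun B => x \in B)) /=.
rewrite (reindex_onto (fun B => x |: B) (fun B => B :\ x)) /=; last first.
  by move=> B /andP[_ xB]; rewrite setD1K.
rewrite addrC (eq_bigr (fun B => (-1) ^+ #|B| * h B)) // addrC.
rewrite (eq_bigl (fun B => (A \subset B) && (B \subset F) && (x \notin B))); last first.
  move=> B /=; rewrite setU11 andbT subUset sub1set xF /=.
  have [xB|xB] := boolP (x \in B).
    rewrite !andbF; apply/negP=> /andP[_ /eqP e].
    by move: xB; rewrite -e !inE eqxx.
  rewrite setU1K // eqxx !andbT; congr (_ && _); apply/idP/idP=> s.
    apply/subsetP=> z zA; move/subsetP: s => /(_ _ zA); rewrite !inE.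
    by case: eqP => // e; rewrite -e zA in xA.
  by apply: subset_trans s _; apply: subsetUr.
rewrite -big_split big1 // => B /andP[/andP[AB BF] xB] /=.
by rewrite hh // cardsU1 xB /= exprS mulN1r mulNr addNr.
Qed.

Lemma chi_loop M x : x \in ground M -> rk M [set x] = 0%N -> chi M = 0.
Proof.
move=> xg rx; rewrite /chi.
rewrite (eq_bigl (fun A => (set0 \subset A) && (A \subset ground M))); last first.
  by move=> A; rewrite sub0set.
apply: (sum_toggle (x := x)); rewrite ?inE // => B _ _ _; congr ('X^(_ - _)).
have := rk_submod M [set x] B; have := @rkS _ M B (x |: B) (subsetUr _ _).
by rewrite rx; lia.
Qed.

Lemma chi_empty M : ground M = set0 -> chi M = 1.
Proof.
move=> e; rewrite /chi e (eq_bigl (pred1 set0)) ?big_pred1_eq; last first.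
  by move=> A; rewrite subset0.
by rewrite cards0 expr0 mul1r /rank e subnn.
Qed.

Lemma chi_contraction M A : A \subset ground M -> chi (contraction M A) =
  (-1) ^+ #|A| * \sum_(B : {set T} | (A \subset B) && (B \subset ground M))
     (-1) ^+ #|B| * 'X^(rank M - rk M B).
Proof.
move=> sA; rewrite mulr_sumr.
rewrite [RHS](reindex_onto (fun B => B :|: A) (fun B => B :\: A)) /=; last first.
  move=> B /andP[AB _]; apply/setP=> z; rewrite !inE.
  by case: (boolP (z \in A)) => [/(subsetP AB) ->|_] //=; rewrite orbF.
rewrite /chi ground_contraction.
have eP B : (B \subset ground M :\: A) =
    (A \subset B :|: A) && (B :|: A \subset ground M) && ((B :|: A) :\: A == B).
  rewrite subsetUr subUset sA andbT setDUl setDv setU0 subsetD /=.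
  congr (_ && _); rewrite eqEsubset subsetDl /= subsetD subxx /=.
  by rewrite disjoint_sym.
apply: eq_big => [B|B sB] //.
rewrite rank_contraction rk_contraction //.
have dBA : [disjoint B & A] by move: sB; rewrite subsetD => /andP[].
have -> : #|B :|: A| = (#|B| + #|A|)%N 
  by apply/eqP; case: (leq_card_setU B A) => _ ->.
rewrite exprD mulrA [_ * ((-1) ^+ #|B| * _)]mulrCA -expr2 sqrr_sign mulr1.
congr (_ * 'X^_); have := @rkS _ M A (B :|: A) (subsetUr _ _).
have := rk_le_rank M (B :|: A); lia.
Qed.

Lemma sum_sign A F : A \subset F ->
  \sum_(B : {set T} | (A \subset B) && (B \subset F)) (-1) ^+ #|B| =
  (if A == F then (-1) ^+ #|A| else 0) :> {poly int}.
Proof.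
move=> AF; case: eqP => [->|ne].
  by rewrite (eq_bigl (pred1 F)) ?big_pred1_eq // => B; rewrite andbC -eqEsubset.
have [x xF xA] : exists2 x, x \in F & x \notin A.
  by apply/subsetPn; apply/negP=> FA; apply: ne; apply/eqP; rewrite eqEsubset AF.
rewrite -[RHS](sum_toggle (h := fun=> 1) xF xA) //.
by apply: eq_bigr => B _; rewrite mulr1.
Qed.

Lemma chi_contraction_nonflat M A : A \subset ground M -> ~~ flat M A ->
  chi (contraction M A) = 0.
Proof.
move=> sA; rewrite /flat sA /= => /forallPn[x]; rewrite negb_imply -leqNgt.
case/andP=> xD l.
apply: (chi_loop (x := x)); first by rewrite ground_contraction.
by rewrite rk_contraction ?sub1set //; apply/eqP; rewrite subn_eq0.
Qed.

(* the flats above A, weighted by the characteristic polynomials of the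
   contractions, recover X^(corank A): Moebius inversion on the Boolean lattice *)
Lemma sum_chi_contraction M A : A \subset ground M ->
  \sum_(F | flat M F && (A \subset F)) chi (contraction M F) = 'X^(rank M - rk M A).
Proof.
have [n] := ubnP (#|ground M| - #|A|); elim: n A => // n IH A ltn sA.
set S := fun B : {set T} => \sum_(F | flat M F && (B \subset F)) chi (contraction M F).
have e1 : \sum_(B : {set T} | (A \subset B) && (B \subset ground M)) (-1) ^+ #|B| * S B
       = (-1) ^+ #|A| * chi (contraction M A).
  under eq_bigr do rewrite mulr_sumr.
  rewrite (exchange_big_dep (fun F => flat M F && (A \subset F))) /=; last first.
    by move=> B F /andP[AB _] /andP[-> BF]; apply: subset_trans BF.
  have -> : (-1) ^+ #|A| * chi (contraction M A) =
      \sum_(F | flat M F && (A \subset F)) (if A == F then (-1) ^+ #|A| else 0) * chi (contraction M F).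
    have [fA|nfA] := boolP (flat M A).
      rewrite (bigD1 A) ?fA ?subxx //= eqxx big1 ?addr0 // => F /andP[_ ne].
      by rewrite eq_sym (negPf ne) mul0r.
    rewrite chi_contraction_nonflat // mulr0 big1 // => F /andP[fF _].
    by case: eqP => [e|]; rewrite ?mul0r //; rewrite e fF in nfA.
  apply: eq_bigr => F /andP[fF AF]; rewrite -sum_sign // mulr_suml.
  apply: eq_bigl => B; rewrite fF /= andbAC -andbA.
  case: (A \subset B) => //=; apply: andb_idr => BF.
  by apply: subset_trans BF _; apply: flat_sub.
have e2 := chi_contraction sA.
have : \sum_(B : {set T} | (A \subset B) && (B \subset ground M)) (-1) ^+ #|B| * S B
     = \sum_(B : {set T} | (A \subset B) && (B \subset ground M)) (-1) ^+ #|B| * 'X^(rank M - rk M B).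
  by rewrite e1 e2 mulrA -expr2 sqrr_sign mul1r.
rewrite (bigD1 A) ?subxx ?sA //= [RHS](bigD1 A) ?subxx ?sA //=.
rewrite [X in _ + X = _](eq_bigr (fun B => (-1) ^+ #|B| * 'X^(rank M - rk M B))).
  by move/addIr/(congr1 ( *%R ((-1) ^+ #|A|))); rewrite !mulrA -!expr2 !sqrr_sign !mul1r.
move=> B /andP[/andP[AB BE] ne]; rewrite /S IH //.
have : (#|A| < #|B|)%N by rewrite proper_card // properEneq eq_sym ne.
have := subset_leq_card BE; lia.
Qed.

Lemma chi_kernel M : ground M != set0 ->
  \sum_(F | flat M F) revp (rk M F) (chi (localization M F)) * chi (contraction M F) = 0.
Proof.
move=> ne.
transitivity (\sum_(F | flat M F) \sum_(A : {set T} | A \subset F)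
    (-1) ^+ #|A| * 'X^(rk M A) * chi (contraction M F)).
  apply: eq_bigr => F fF; rewrite -rank_localization revp_chi mulr_suml.
  by apply: eq_bigr => A AF; rewrite rk_localization.
rewrite (exchange_big_dep (fun A => A \subset ground M)) /=; last first.
  by move=> F A fF AF; apply: subset_trans AF (flat_sub fF).
transitivity (\sum_(A : {set T} | A \subset ground M) (-1) ^+ #|A| * 'X^(rank M) : {poly int}).
  apply: eq_bigr => A sA; rewrite -mulr_sumr sum_chi_contraction // -mulrA -exprD.
  by rewrite subnKC // rk_le_rank.
rewrite -mulr_suml; have := sum_sign (sub0set (ground M)).
rewrite eq_sym (negPf ne) => e.
rewrite (eq_bigl (fun B => (set0 \subset B) && (B \subset ground M))); last first.
  by move=> A; rewrite sub0set.
by rewrite e mul0r.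
Qed.

End CharPoly.

Section KLAxioms.
Context {T : finType}.
Implicit Types (M : matroid T) (F : {set T}) (P Q : matroid T -> {poly int}).

Definition KL_rank0 P M : bool :=
  (rank M == 0%N) ==> (P M == if ground M == set0 then 1 else 0).

(* deg P < rank / 2; [size] is degree + 1, and 0 for the zero polynomial, which
   satisfies the bound. *)
Definition KL_degree P M : bool :=
  (0 < rank M)%N ==> (2 * (size (P M)).-1 < rank M)%N.

Definition KL_equation P M : bool :=
  revp (rank M) (P M) ==
  \sum_(F | flat M F) chi (localization M F) * P (contraction M F).

Definition inverse_KL_equation Q M : bool :=
  (-1) ^+ rank M * revp (rank M) (Q M) ==
  \sum_(F | flat M F) (-1) ^+ rk M F * Q (localization M F)
                      * revp (rank M - rk M F) (chi (contraction M F)).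

Definition KL_assignment P : bool :=
  [forall M, [&& KL_rank0 P M, KL_degree P M & KL_equation P M]].

Definition inverse_KL_assignment Q : bool :=
  [forall M, [&& KL_rank0 Q M, KL_degree Q M & inverse_KL_equation Q M]].

End KLAxioms.

Section Halves.
Implicit Types (R P : {poly int}).

Definition halfp (r : nat) R : {poly int} := - \poly_(i < uphalf r) R`_i.

Lemma degree_halfp r R : (0 < r)%N -> (2 * (size (halfp r R)).-1 < r)%N.
Proof.
move=> r0; rewrite /halfp size_polyN; have := size_poly (uphalf r) (fun i => R`_i).
move: (size _) => n; rewrite uphalf_half; have := odd_double_half r; lia.
Qed.

Lemma revp_halfp r R : (size R <= r.+1)%N -> revp r R = - R ->
  revp r (halfp r R) - halfp r R = R.
Proof.
move=> sR eR; apply/polyP=> i; rewrite coefB coef_revp /halfp !coefN !coef_poly.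
have hR : (i <= r)%N -> R`_(r - i) = - R`_i.
  by move=> h; have := coef_revp r R i; rewrite h eR coefN.
have hi : (i < uphalf r)%N = (2 * i < r)%N by rewrite uphalf_half; have := odd_double_half r; lia.
have hj : (r - i < uphalf r)%N = (2 * (r - i) < r)%N by rewrite uphalf_half; have := odd_double_half r; lia.
rewrite hi hj opprK; case: (leqP i r) => h; last first.
  rewrite (@nth_default _ _ R i); last exact: leq_trans sR h.
  by rewrite add0r; case: ifP.
rewrite (hR h); case: ifP => h1; case: ifP => h2; rewrite ?opprK ?oppr0 ?addr0 ?add0r //; try lia.
have e : (r - i = i)%N by lia.
by have := hR h; rewrite e; lia.
Qed.

Lemma revp_eq0 r P : (0 < r)%N -> (2 * (size P).-1 < r)%N -> revp r P = P -> P = 0.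
Proof.
move=> r0 dP e; apply/polyP=> i; rewrite coef0.
have [h|h] := ltnP i (size P); last by rewrite nth_default.
rewrite -e coef_revp ifT; last by lia.
by rewrite nth_default //; move: h dP; move: (size P) => n; lia.
Qed.

Lemma size_degree r P : (0 < r)%N -> (2 * (size P).-1 < r)%N -> (size P <= r.+1)%N.
Proof. by move: (size P) => n; lia. Qed.

End Halves.

Section Existence.
Context {T : finType}.
Implicit Types (M : matroid T) (F G : {set T}) (P Q : matroid T -> {poly int}).

Lemma KL_size P M : KL_rank0 P M -> KL_degree P M -> (size (P M) <= (rank M).+1)%N.
Proof.
rewrite /KL_rank0 /KL_degree; case: (posnP (rank M)) => [-> /= /eqP -> _|r0 _ /=].
  by case: ifP; rewrite ?size_poly1 ?size_poly0.
exact: size_degree.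
Qed.

Lemma rk0 M : rk M set0 = 0%N.
Proof. by apply/eqP; rewrite -leqn0 -(cards0 T) rk_card. Qed.

Lemma flat0_loop M : ~~ flat M set0 -> exists2 x, x \in ground M & rk M [set x] = 0%N.
Proof.
rewrite /flat sub0set /= => /forallPn[x]; rewrite negb_imply setD0 -leqNgt setU0 rk0.
by case/andP=> xg; rewrite leqn0 => /eqP; exists x.
Qed.

Lemma flat_rk_rank0 M F : rank M = 0%N -> flat M F = (F == ground M).
Proof.
move=> r0; apply/idP/eqP=> [/flatP[s h]|->]; last exact: flat_ground.
apply/eqP; rewrite eqEsubset s /=; apply/subsetP=> x xg; apply: contraT => xF.
by have := h _ xg xF; have := rk_le_rank M (x |: F); lia.
Qed.

Lemma loop_sub_flat M F x : rk M [set x] = 0%N -> x \in ground M -> flat M F -> x \in F.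
Proof.
move=> rx xg /flatP[s h]; apply: contraT => xF.
by have := h _ xg xF; have := rk_submod M [set x] F; rewrite rx; lia.
Qed.

Lemma chi_localization_loop M F x : rk M [set x] = 0%N -> x \in ground M ->
  flat M F -> chi (localization M F) = 0.
Proof.
move=> rx xg fF; have xF := loop_sub_flat rx xg fF.
by apply: (chi_loop (x := x)) => //; rewrite rk_localization ?sub1set.
Qed.

Lemma sum_flat_contraction M F (f : {set T} -> {poly int}) : F \subset ground M ->
  \sum_(G | flat (contraction M F) G) f G =
  \sum_(G | flat M G && (F \subset G)) f (G :\: F).
Proof.
move=> sF; rewrite [RHS](reindex_onto (fun G => G :|: F) (fun G => G :\: F)) /=; last first.
  move=> B /andP[_ AB]; apply/setP=> z; rewrite !inE.
  by case: (boolP (z \in F)) => [/(subsetP AB) ->|_] //=; rewrite orbF.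
have e G : G \subset ground M :\: F -> (G :|: F) :\: F = G.
  rewrite subsetD => /andP[_ d]; rewrite setDUl setDv setU0; apply/setDidPl.
  exact: d.
apply: eq_big => [G|G fG]; last by rewrite e //; apply: (flat_sub fG).
rewrite subsetUr andbT; have [s|ns] := boolP (G \subset ground M :\: F).
  by rewrite flat_contraction // e // eqxx andbT.
rewrite /flat ground_contraction (negPf ns) /=; apply/esym/negP.
case/andP=> /andP[s _] /eqP eG; case/negP: ns; rewrite -eG.
by apply: setSD.
Qed.

Lemma sum_flat_localization M F (f : {set T} -> {poly int}) : flat M F ->
  \sum_(G | flat (localization M F) G) f G = \sum_(G | flat M G && (G \subset F)) f G.
Proof. by move=> fF; apply: eq_bigl => G; rewrite flat_localization. Qed.

Definition KL_tail P M : {poly int} :=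
  \sum_(F | flat M F && (F != set0)) chi (localization M F) * P (contraction M F).

Lemma card_contraction M F : F \subset ground M -> F != set0 ->
  (#|ground (contraction M F)| < #|ground M|)%N.
Proof.
move=> s ne; rewrite ground_contraction cardsD (setIidPr s).
by have := subset_leq_card s; move: ne; rewrite -card_gt0; lia.
Qed.

Lemma card_localization M F : F \subset ground M -> F != ground M ->
  (#|ground (localization M F)| < #|ground M|)%N.
Proof. by move=> s ne; apply: proper_card; rewrite properEneq ne. Qed.

Lemma rank_le_card M : (rank M <= #|ground M|)%N.
Proof. exact: rk_card. Qed.

Definition KL_at P M := [&& KL_rank0 P M, KL_degree P M & KL_equation P M].

Lemma size_KL_tail P M :
  (forall N, (#|ground N| < #|ground M|)%N -> KL_at P N) ->
  (size (KL_tail P M) <= (rank M).+1)%N.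
Proof.
move=> IH; apply: leq_trans (size_sum _ _ _) _; apply/bigmax_leqP=> F /andP[fF nF].
have /and3P[a b _] := IH _ (card_contraction (flat_sub fF) nF).
have := KL_size a b; have := size_chi (localization M F).
rewrite rank_contraction rank_localization => h1 h2.
apply: leq_trans (size_polyMleq _ _) _; have := rk_le_rank M F; lia.
Qed.

Lemma revp_KL_tail P M :
  (forall N, (#|ground N| < #|ground M|)%N -> KL_at P N) ->
  flat M set0 -> revp (rank M) (KL_tail P M) = - KL_tail P M.
Proof.
move=> IH f0; rewrite /KL_tail linear_sum /=.
transitivity (\sum_(F | flat M F && (F != set0)) \sum_(G | flat M G && (F \subset G))
   revp (rk M F) (chi (localization M F)) * chi (contraction (localization M G) F)
     * P (contraction M G)).
  apply: eq_bigr => F /andP[fF nF]; have sF := flat_sub fF.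
  have /and3P[a b /eqP c] := IH _ (card_contraction sF nF).
  have -> : rank M = (rk M F + rank (contraction M F))%N.
    by rewrite rank_contraction subnKC // rk_le_rank.
  rewrite revpM ?c ?KL_size //; last by rewrite -rank_localization size_chi.
  rewrite (@sum_flat_contraction M F _ sF) mulr_sumr; apply: eq_bigr => G /andP[fG FG].
  by rewrite localization_contraction ?contractionK ?flat_sub // mulrA.
rewrite (exchange_big_dep (fun G => flat M G && (G != set0))) /=; last first.
  move=> F G /andP[_ nF] /andP[-> FG] /=; apply: contra nF => /eqP e.
  by rewrite -subset0 -e.
rewrite -sumrN; apply: eq_bigr => G /andP[fG nG]; rewrite -mulr_suml -mulNr.
congr (_ * _); have := @chi_kernel _ (localization M G) nG.
rewrite sum_flat_localization // (bigD1 set0) ?f0 ?sub0set //= => /eqP.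
rewrite addrC addr_eq0 contraction0 localizationK ?sub0set // chi_empty //.
rewrite rk0 (_ : revp 0 1 = 1) ?mul1r; last first.
  by rewrite -(expr0 'X) revpXn // subnn.
move=> /eqP <-; apply: eq_big => [F|F]; first by rewrite fG /= andbAC.
move=> /andP[/andP[fF nF] /andP[_ FG]].
by rewrite localizationK // rk_localization.
Qed.

Lemma KL_tail_loop P M : ~~ flat M set0 -> KL_tail P M = 0.
Proof.
move=> /flat0_loop[x xg rx]; rewrite /KL_tail big1 // => F /andP[fF _].
by rewrite (chi_localization_loop rx xg fF) mul0r.
Qed.

Lemma KL_sumE P M : \sum_(F | flat M F) chi (localization M F) * P (contraction M F)
  = (if flat M set0 then P M else 0) + KL_tail P M.
Proof.
case: ifP => f0.
  by rewrite (bigD1 set0) //= contraction0 chi_empty // mul1r.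
rewrite add0r; apply: eq_bigl => F; case: eqP => [->|]; rewrite ?f0 //= andbT //.
Qed.

Lemma KL_atP P M :
  (forall N, (#|ground N| < #|ground M|)%N -> KL_at P N) ->
  P M = (if rank M == 0%N then (if ground M == set0 then 1 else 0)
         else halfp (rank M) (KL_tail P M)) -> KL_at P M.
Proof.
move=> IH eP; rewrite /KL_at /KL_rank0 /KL_degree /KL_equation KL_sumE.
case: (posnP (rank M)) => [r0|rp]; last first.
  rewrite gtn_eqF //= in eP *; rewrite eP degree_halfp //=.
  have [f0|f0] := boolP (flat M set0).
    rewrite -{3}(revp_halfp (size_KL_tail IH) (revp_KL_tail IH f0)).
    by rewrite addrC subrK.
  rewrite KL_tail_loop // addr0 /halfp.
  by rewrite (_ : \poly_(i < _) _ = 0) ?oppr0 ?linear0 //; apply/polyP=> i; rewrite coef_poly !coef0 if_same.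
rewrite r0 eqxx /= in eP *; rewrite eP eqxx /=.
have r1 : revp 0 1 = 1 by rewrite -(expr0 'X) revpXn // subnn.
rewrite /KL_tail; have [e|ne] := eqVneq (ground M) set0.
  have -> : flat M set0 by rewrite flat_rk_rank0 // e.
  by rewrite r1 big1 ?addr0 // => F; rewrite flat_rk_rank0 // e andbN.
rewrite linear0 if_same add0r eq_sym big1 // => F /andP[fF _].
have [x xg] := set0Pn _ ne.
rewrite (@chi_localization_loop M F x) ?mul0r //.
by have := rk_le_rank M [set x]; lia.
Qed.

Lemma KL_at_eq P P' M :
  (forall N, (#|ground N| <= #|ground M|)%N -> P N = P' N) -> KL_at P M = KL_at P' M.
Proof.
move=> e; rewrite /KL_at /KL_rank0 /KL_degree /KL_equation e //; congr [&& _, _ & _ == _].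
apply: eq_bigr => F fF; rewrite e // ground_contraction.
by rewrite subset_leq_card // subsetDl.
Qed.

Lemma KL_exists_fun : exists P, forall M, KL_at P M.
Proof.
suff [P h] : exists P, forall M, (#|ground M| < #|T|.+1)%N -> KL_at P M.
  by exists P => M; apply: h; rewrite ltnS max_card.
elim: #|T|.+1 => [|n [P IH]]; first by exists (fun=> 0).
pose P' M := if (#|ground M| < n)%N then P M
  else if rank M == 0%N then (if ground M == set0 then 1 else 0)
         else halfp (rank M) (KL_tail P M).
have lt M : (#|ground M| < n)%N -> KL_at P' M.
  move=> h; rewrite -(@KL_at_eq P) ?IH // => N l; rewrite /P' ifT //.
  exact: leq_ltn_trans h.
exists P' => M; rewrite ltnS leq_eqVlt => /orP[/eqP eM|]; last exact: lt.
apply: KL_atP => [N|]; rewrite ?eM; first exact: lt.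
rewrite {1}/P' eM ltnn; case: ifP => // _; congr halfp.
apply: eq_bigr => F /andP[fF nF]; rewrite /P' ifT //.
by rewrite -eM card_contraction // flat_sub.
Qed.

Lemma KL_unique_fun P P' : (forall M, KL_at P M) -> (forall M, KL_at P' M) -> P =1 P'.
Proof.
move=> hP hP' M; have [n] := ubnP #|ground M|; elim: n M => // n IH M ltn.
have /and3P[a b c] := hP M; have /and3P[a' b' c'] := hP' M.
case: (posnP (rank M)) => [r0|rp].
  by move: a a'; rewrite /KL_rank0 r0 /= => /eqP -> /eqP ->.
have sP := KL_size a b; have sP' := KL_size a' b'.
move: b b' c c'; rewrite /KL_degree /KL_equation !KL_sumE rp /= => b b' /eqP c /eqP c'.
have et : KL_tail P M = KL_tail P' M.
  apply: eq_bigr => F /andP[fF nF]; rewrite IH //.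
  by have := card_contraction (flat_sub fF) nF; lia.
apply/eqP; rewrite -subr_eq0; apply/eqP; case: (boolP (flat M set0)) c c' => f0 c c'.
  apply: (revp_eq0 rp).
    apply: leq_ltn_trans (_ : 2 * (maxn (size (P M)) (size (P' M))).-1 < _)%N.
      rewrite leq_mul2l /=; have := size_polyD (P M) (- P' M).
      by rewrite size_polyN => hs; rewrite -!subn1 leq_sub2r.
    by move: b b'; move: (size (P M)) (size (P' M)) => s s'; lia.
  by rewrite linearB /= c c' et opprD addrACA subrr addr0.
by rewrite -(revpK sP) -(revpK sP') c c' et subrr.
Qed.

Definition iKL_at Q M := [&& KL_rank0 Q M, KL_degree Q M & inverse_KL_equation Q M].

Definition iKL_tail Q M : {poly int} :=
  \sum_(F | flat M F && (F != ground M)) (-1) ^+ rk M F * Q (localization M F)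
     * revp (rank M - rk M F) (chi (contraction M F)).

Lemma iKL_sumE Q M : \sum_(F | flat M F) (-1) ^+ rk M F * Q (localization M F)
     * revp (rank M - rk M F) (chi (contraction M F))
  = (-1) ^+ rank M * Q M + iKL_tail Q M.
Proof.
rewrite (bigD1 (ground M)) ?flat_ground //= localizationT -/(rank M) subnn.
rewrite chi_empty; last by rewrite ground_contraction setDv.
by rewrite (_ : revp 0 1 = 1) ?mulr1 // -(expr0 'X) revpXn // subnn.
Qed.

Lemma size_sign_mul (a : nat) (p : {poly int}) : size ((-1) ^+ a * p) = size p.
Proof. by rewrite -signr_odd mulr_sign; case: odd; rewrite ?size_polyN. Qed.

Lemma revp_sign_mul (a n : nat) (p : {poly int}) : revp n ((-1) ^+ a * p) = (-1) ^+ a * revp n p.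
Proof. by rewrite -signr_odd !mulr_sign; case: odd; rewrite ?linearN. Qed.

Lemma size_iKL_tail Q M :
  (forall N, (#|ground N| < #|ground M|)%N -> iKL_at Q N) ->
  (size (iKL_tail Q M) <= (rank M).+1)%N.
Proof.
move=> IH; apply: leq_trans (size_sum _ _ _) _; apply/bigmax_leqP=> F /andP[fF nF].
have /and3P[a b _] := IH _ (card_localization (flat_sub fF) nF).
have := KL_size a b; have := size_revp (rank M - rk M F) (chi (contraction M F)).
rewrite rank_localization -mulrA size_sign_mul => h1 h2.
apply: leq_trans (size_polyMleq _ _) _; have := rk_le_rank M F; lia.
Qed.

Lemma revp_iKL_tail Q M :
  (forall N, (#|ground N| < #|ground M|)%N -> iKL_at Q N) ->
  revp (rank M) (iKL_tail Q M) = - iKL_tail Q M.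
Proof.
move=> IH; rewrite /iKL_tail linear_sum /=.
transitivity (\sum_(F | flat M F && (F != ground M)) \sum_(G | flat M G && (G \subset F))
   ((-1) ^+ rk M G * Q (localization M G)) *
   (revp (rk M F - rk M G) (chi (localization (contraction M G) (F :\: G)))
     * chi (contraction (contraction M G) (F :\: G)))).
  apply: eq_bigr => F /andP[fF nF]; have sF := flat_sub fF.
  have /and3P[a b /eqP c] := IH _ (card_localization sF nF).
  have eM : rank M = (rk M F + (rank M - rk M F))%N by rewrite subnKC // rk_le_rank.
  rewrite {1}eM -mulrA revp_sign_mul revpM; first last.
  - exact: size_revp.
  - by rewrite -rank_localization KL_size.
  rewrite revpK; last by rewrite -rank_contraction size_chi.
  rewrite mulrA; rewrite rank_localization in c; rewrite c.
  rewrite sum_flat_localization // mulr_suml; apply: eq_bigr => G /andP[fG GF].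
  rewrite localizationK // rk_localization // -localization_contraction //.
  by rewrite contractionK // mulrA.
rewrite (exchange_big_dep (fun G => flat M G && (G != ground M))) /=; last first.
  move=> F G /andP[fF nF] /andP[-> GF] /=; apply: contra nF => /eqP e.
  by rewrite eqEsubset (flat_sub fF) -e.
rewrite -sumrN; apply: eq_bigr => G /andP[fG nG]; rewrite -mulr_sumr -mulrN.
congr (_ * _); have sG := flat_sub fG.
have nC : ground (contraction M G) != set0.
  by rewrite ground_contraction setD_eq0; apply: contra nG => s; rewrite eqEsubset sG.
have := chi_kernel nC.
rewrite sum_flat_contraction // (bigD1 (ground M)) ?flat_ground //= => /eqP.
rewrite addrC addr_eq0 -/(ground (contraction M G)) localizationT -/(rank _) rank_contraction.
rewrite (@chi_empty _ (contraction (contraction M G) _)); last first.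
  by rewrite !ground_contraction setDv.
rewrite mulr1 => /eqP <-; apply: eq_big => [F|F].
  by rewrite fG /= andbAC.
move=> /andP[/andP[fF nF] /andP[_ GF]]; congr (revp _ _ * _).
rewrite rk_contraction ?setSD ?flat_sub //; congr (rk M _ - _)%N.
by apply/setP=> z; rewrite !inE; case: (boolP (z \in G)) => [/(subsetP GF) ->|_] //=; rewrite orbF.
Qed.

Lemma iKL_atP Q M :
  (forall N, (#|ground N| < #|ground M|)%N -> iKL_at Q N) ->
  Q M = (if rank M == 0%N then (if ground M == set0 then 1 else 0)
         else halfp (rank M) ((-1) ^+ rank M * iKL_tail Q M)) -> iKL_at Q M.
Proof.
move=> IH eQ; rewrite /iKL_at /KL_rank0 /KL_degree /inverse_KL_equation iKL_sumE.
case: (posnP (rank M)) => [r0|rp]; last first.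
  rewrite gtn_eqF //= in eQ *; rewrite eQ degree_halfp //=.
  set R := (-1) ^+ rank M * iKL_tail Q M.
  have sR : (size R <= (rank M).+1)%N by rewrite size_sign_mul size_iKL_tail.
  have eR : revp (rank M) R = - R by rewrite revp_sign_mul revp_iKL_tail // mulrN.
  have -> : iKL_tail Q M = (-1) ^+ rank M * R by rewrite mulrA -expr2 sqrr_sign mul1r.
  by rewrite -mulrDr -{3}(revp_halfp sR eR) addrC subrK.
rewrite r0 eqxx /= in eQ *; rewrite eQ eqxx /= !expr0 !mul1r.
rewrite /iKL_tail big1 ?addr0; last by move=> F; rewrite flat_rk_rank0 // andbN.
by case: ifP => _; rewrite ?linear0 // -(expr0 'X) revpXn // subnn.
Qed.

Lemma iKL_at_eq Q Q' M :
  (forall N, (#|ground N| <= #|ground M|)%N -> Q N = Q' N) -> iKL_at Q M = iKL_at Q' M.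
Proof.
move=> e; rewrite /iKL_at /KL_rank0 /KL_degree /inverse_KL_equation e //.
congr [&& _, _ & _ == _].
apply: eq_bigr => F fF; rewrite e // ground_localization.
by rewrite subset_leq_card // flat_sub.
Qed.

Lemma iKL_exists_fun : exists Q, forall M, iKL_at Q M.
Proof.
suff [Q h] : exists Q, forall M, (#|ground M| < #|T|.+1)%N -> iKL_at Q M.
  by exists Q => M; apply: h; rewrite ltnS max_card.
elim: #|T|.+1 => [|n [Q IH]]; first by exists (fun=> 0).
pose Q' M := if (#|ground M| < n)%N then Q M
  else if rank M == 0%N then (if ground M == set0 then 1 else 0)
         else halfp (rank M) ((-1) ^+ rank M * iKL_tail Q M).
have lt M : (#|ground M| < n)%N -> iKL_at Q' M.
  move=> h; rewrite -(@iKL_at_eq Q) ?IH // => N l; rewrite /Q' ifT //.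
  exact: leq_ltn_trans h.
exists Q' => M; rewrite ltnS leq_eqVlt => /orP[/eqP eM|]; last exact: lt.
apply: iKL_atP => [N|]; rewrite ?eM; first exact: lt.
rewrite {1}/Q' eM ltnn; case: ifP => // _; congr halfp; congr (_ * _).
apply: eq_bigr => F /andP[fF nF]; rewrite /Q' ifT //.
by rewrite -eM card_localization // flat_sub.
Qed.

Lemma iKL_unique_fun Q Q' : (forall M, iKL_at Q M) -> (forall M, iKL_at Q' M) -> Q =1 Q'.
Proof.
move=> hQ hQ' M; have [n] := ubnP #|ground M|; elim: n M => // n IH M ltn.
have /and3P[a b c] := hQ M; have /and3P[a' b' c'] := hQ' M.
case: (posnP (rank M)) => [r0|rp].
  by move: a a'; rewrite /KL_rank0 r0 /= => /eqP -> /eqP ->.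
move: b b' c c'; rewrite /KL_degree /inverse_KL_equation !iKL_sumE rp /= => b b' /eqP c /eqP c'.
have et : iKL_tail Q M = iKL_tail Q' M.
  apply: eq_bigr => F /andP[fF nF]; rewrite IH //.
  by have := card_localization (flat_sub fF) nF; lia.
apply/eqP; rewrite -subr_eq0; apply/eqP; apply: (revp_eq0 rp).
  apply: leq_ltn_trans (_ : 2 * (maxn (size (Q M)) (size (Q' M))).-1 < _)%N.
    rewrite leq_mul2l /=; have := size_polyD (Q M) (- Q' M).
    by rewrite size_polyN => hs; rewrite -!subn1 leq_sub2r.
  by move: b b'; move: (size (Q M)) (size (Q' M)) => s s'; lia.
have : (-1) ^+ rank M * revp (rank M) (Q M - Q' M) = (-1) ^+ rank M * (Q M - Q' M).
  by rewrite linearB /= mulrBr c c' et opprD addrACA subrr addr0 mulrBr.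
by move/(congr1 ( *%R ((-1) ^+ rank M))); rewrite !mulrA -!expr2 !sqrr_sign !mul1r.
Qed.

End Existence.

Section KLPolynomials.
Variable T : finType.

Fact KL_exists : exists P : {ffun matroid T -> {poly int}}, KL_assignment P.
Proof.
have [P hP] := @KL_exists_fun T; exists [ffun M => P M]; apply/forallP=> M.
by have := hP M; rewrite (@KL_at_eq _ P [ffun M => P M]) // => N _; rewrite ffunE.
Qed.

Fact inverse_KL_exists :
  exists Q : {ffun matroid T -> {poly int}}, inverse_KL_assignment Q.
Proof.
have [Q hQ] := @iKL_exists_fun T; exists [ffun M => Q M]; apply/forallP=> M.
by have := hQ M; rewrite (@iKL_at_eq _ Q [ffun M => Q M]) // => N _; rewrite ffunE.
Qed.

Lemma KL_unique (P P' : matroid T -> {poly int}) :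
  KL_assignment P -> KL_assignment P' -> P =1 P'.
Proof. by move=> /forallP h /forallP h'; apply: KL_unique_fun. Qed.

Lemma inverse_KL_unique (Q Q' : matroid T -> {poly int}) :
  inverse_KL_assignment Q -> inverse_KL_assignment Q' -> Q =1 Q'.
Proof. by move=> /forallP h /forallP h'; apply: iKL_unique_fun. Qed.

End KLPolynomials.

(* All matroids on subsets of T are handled at once: this class is closed under
   localization and contraction, so the conditions determine the assignment on
   it ([KL_unique], [inverse_KL_unique]). *)
Definition KL (T : finType) (M : matroid T) : {poly int} :=
  xchoose (KL_exists T) M.

Definition inverse_KL (T : finType) (M : matroid T) : {poly int} :=
  xchoose (inverse_KL_exists T) M.

Lemma KLP (T : finType) : KL_assignment (@KL T).
Proof. exact: (xchooseP (KL_exists T)). Qed.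

Lemma inverse_KLP (T : finType) : inverse_KL_assignment (@inverse_KL T).
Proof. exact: (xchooseP (inverse_KL_exists T)). Qed.

Definition Zpoly (T : finType) (M : matroid T) : {poly int} :=
  \sum_(F | flat M F) 'X^(rk M F) * KL (contraction M F).

(* Main.v *)
(* Write f * g for the convolution M |-> \sum_F f(M^F) g(M_F) over the flats F. The three
   polynomials are governed by such convolutions: t^rk P(1/t) = chi * P, Z = t^rk * P, and, up to
   sign, t^rk Q(1/t) = ((-1)^rk Q) * (t^rk chi(1/t)). Each right factor vanishes on matroids with a
   loop, so F may range over all subsets of E, and M and its relaxation N can be compared subset by
   subset. Let k be the rank. A subset A not contained in H contributes the same to M and N, unless
   A = E. If A <= H and |A| < k, then A is independent, M|A = N|A, and N/A is the relaxation of M/A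
   at H - A. If A <= H and |A| >= k, then only A = H can contribute, and only for M, through the
   uniform matroid M|H and the rank one matroid M/H. Hence every difference depends on k and |H|
   alone, and the degree bound recovers P_N - P_M and Q_N - Q_M from p |-> t^k p(1/t) - p. *)
Require Import Defs.
From mathcomp Require Import all_boot all_order all_algebra.
From mathcomp Require Import zify ring.

Set Implicit Arguments.
Unset Strict Implicit.
Unset Printing Implicit Defensive.

Import GRing.Theory.

Section SubsetSums.
Local Open Scope ring_scope.

Lemma sum_subsets_by_card (T : finType) (V : nmodType) (A : {set T}) (m n : nat)
    (g : nat -> V) :
  \sum_(S : {set T} | (S \subset A) && (m <= #|S| < n)%N) g #|S| =
   \sum_(m <= i < n) g i *+ 'C(#|A|, i).
Proof.
transitivity (\sum_(m <= i < n) \sum_(S : {set T} | (S \subset A) && (#|S| == i)) g i).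
  rewrite (exchange_big_dep (fun S : {set T} => S \subset A)) //=; last first.
    by move=> i S _ /andP[].
  rewrite big_mkcondr; apply: eq_bigr => S SA; rewrite -(@big_nat1_eq _ _ +%R).
  by apply: eq_bigl => i; rewrite SA eq_sym.
apply: eq_bigr => i _; rewrite -cards_draws -sumr_const.
by apply: eq_bigl => S; rewrite inE.
Qed.

Lemma sum_signed_binomial (R : comPzRingType) (x : R) (n : nat) :
  \sum_(0 <= i < n) ((-1) ^+ i * (1 - x) ^+ (n - i)) *+ 'C(n, i) = (-1) ^+ n * (x ^+ n - 1).
Proof.
rewrite mulrBr mulr1 -exprNn -[X in _ = X ^+ n - _](addKr 1) [X in _ = X ^+ n - _]addrC.
rewrite exprBn big_ord_recr /= subnn expr0 mulr1 expr1n !mulr1 binn mulr1n addrK.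
by rewrite big_mkord; apply: eq_bigr => i _; rewrite expr1n mulr1.
Qed.

End SubsetSums.

Section Matroids.
Context {T : finType}.
Implicit Types (M : matroid T) (A F : {set T}).

Lemma flat_full_rank M F : flat M F -> rk M F = rank M -> F = ground M.
Proof.
move=> /flatP[s h] r; apply/eqP; rewrite eqEsubset s; apply/subsetP=> x xg.
by apply: contraT => xF; have := h x xg xF; have := rk_le_rank M (x |: F); lia.
Qed.

Lemma rk_setU1_flat M F A x : flat M F -> A \subset F -> x \in ground M -> x \notin F ->
  rk M (x |: A) = (rk M A).+1.
Proof.
move=> /flatP[_ hF] AF xg xF; have := hF x xg xF.
have := rk_submod M F (x |: A); have := rk_submod M [set x] A.
have := rk_card M [set x]; rewrite cards1.
have -> : F :|: (x |: A) = x |: F by rewrite setUCA (setUidPl AF).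
have : rk M A <= rk M (F :&: (x |: A)) by rewrite rkS // subsetI AF subsetUr.
lia.
Qed.

Lemma rk_indep M A : indep M A -> rk M A = #|A|.
Proof. by rewrite indepE => /eqP. Qed.

Lemma flat0_contraction M F : flat M F -> flat (contraction M F) set0.
Proof. by move=> fF; rewrite flat_contraction ?sub0set ?(flat_sub fF) // set0U. Qed.

Definition uniform M : Prop :=
  forall A, A \subset ground M -> rk M A = minn #|A| (rank M).

Definition boolean M : bool := indep M (ground M).

Lemma uniform_indep M A : uniform M -> A \subset ground M -> #|A| <= rank M -> indep M A.
Proof. by move=> u Ag le; rewrite indepE u // (minn_idPl le). Qed.

Lemma uniform_contraction M F : uniform M -> F \subset ground M ->
  uniform (contraction M F).
Proof.
move=> u Fg A sA; have := sA; rewrite subsetD => /andP[Ag d].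
rewrite rk_contraction // rank_contraction !u ?subUset ?Ag //.
by rewrite cardsU (disjoint_setI0 d) cards0; lia.
Qed.

Lemma rank_boolean M : boolean M -> rank M = #|ground M|.
Proof. exact: rk_indep. Qed.

Lemma rk_boolean M A : boolean M -> A \subset ground M -> rk M A = #|A|.
Proof. by move=> b Ag; apply: rk_indep (indep_sub b Ag). Qed.

Lemma uniform_boolean M : boolean M -> uniform M.
Proof.
move=> b A Ag; rewrite (rk_boolean b Ag) (rank_boolean b).
by rewrite (minn_idPl (subset_leq_card Ag)).
Qed.

Lemma boolean_localization M F : indep M F -> boolean (localization M F).
Proof. by rewrite /boolean ground_localization !indepE rk_localization. Qed.

Lemma boolean_contraction M F : boolean M -> F \subset ground M -> boolean (contraction M F).
Proof.
move=> b Fg; rewrite /boolean indepE -/(rank _) rank_contraction ground_contraction.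
by rewrite cardsDS // (rank_boolean b) (rk_boolean b).
Qed.

End Matroids.

Section CharacteristicPolynomials.
Local Open Scope ring_scope.

(* The truncated [r - i] is the corank of an i-subset of U_{r,n}, also for [r < i]. *)
Definition chi_uniform (r n : nat) : {poly int} :=
  \sum_(0 <= i < n.+1) ((-1) ^+ i * 'X^(r - i)) *+ 'C(n, i).

Lemma chi_uniform_boolean n : chi_uniform n n = ('X - 1) ^+ n.
Proof.
rewrite exprBn /chi_uniform big_mkord; apply: eq_bigr => i _.
by rewrite expr1n mulr1.
Qed.

Lemma revp0_1 : revp 0 1 = 1.
Proof. by rewrite -(expr0 'X) revpXn. Qed.

Lemma revp_Xsub1_exp n : revp n (('X - 1) ^+ n) = (1 - 'X) ^+ n.
Proof.
elim: n => [|n IH]; first by rewrite !expr0 revp0_1.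
rewrite !exprSr -addn1 revpM ?IH ?size_exp_XsubC ?size_XsubC //.
by rewrite linearB /= -['X in LHS]expr1 -(expr0 'X) !revpXn // expr0 expr1.
Qed.

Context {T : finType}.
Implicit Types (M : matroid T) (A F : {set T}).

Lemma chi_uniformE M : uniform M -> chi M = chi_uniform (rank M) #|ground M|.
Proof.
move=> u; rewrite /chi_uniform.
rewrite -(sum_subsets_by_card (ground M) 0 _ (fun i => (-1) ^+ i * 'X^(rank M - i))).
apply: eq_big => [A|A Ag].
  by apply/esym/andb_idr => Ag; rewrite ltnS subset_leq_card.
by rewrite u //; congr (_ * 'X^_); lia.
Qed.

Lemma chi_boolean M : boolean M -> chi M = ('X - 1) ^+ #|ground M|.
Proof.
move=> b; rewrite chi_uniformE; last exact: uniform_boolean.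
by rewrite (rank_boolean b) chi_uniform_boolean.
Qed.

Lemma sum_flat_rank1 (V : nmodType) (f : {set T} -> V) M : rank M = 1%N -> flat M set0 ->
  \sum_(F | flat M F) f F = f set0 + f (ground M).
Proof.
move=> r f0; have n0 : ground M != set0.
  by apply/eqP=> e; move: r; rewrite /rank e rk0.
rewrite (bigD1 set0) //= (bigD1 (ground M)) ?flat_ground //= big1 ?addr0 //.
move=> F /andP[/andP[fF /set0Pn[x xF]] /eqP[]]; apply: flat_full_rank => //.
have := rk_setU1_flat f0 (sub0set set0) (subsetP (flat_sub fF) x xF) (negbT (in_set0 x)).
have : (rk M (x |: set0) <= rk M F)%N by rewrite rkS // setU0 sub1set.
have := rk_le_rank M F; lia.
Qed.

Lemma chi_contraction_ground M : chi (contraction M (ground M)) = 1.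
Proof. by apply: chi_empty; rewrite ground_contraction setDv. Qed.

Lemma chi_rank1 M : rank M = 1%N -> flat M set0 -> chi M = 'X - 1.
Proof.
move=> r f0; have := sum_chi_contraction (sub0set (ground M)).
rewrite (eq_bigl (flat M)) => [|F]; last by rewrite sub0set andbT.
rewrite sum_flat_rank1 // contraction0 chi_contraction_ground rk0 subn0 r expr1 => <-.
by rewrite addrK.
Qed.

End CharacteristicPolynomials.

Section FlatConvolution.
Context {T : finType} {R : pzRingType}.
Implicit Types (M : matroid T) (A F : {set T}) (f g : matroid T -> R).
Local Open Scope ring_scope.

Definition flat_convolution f g M : R :=
  \sum_(F | flat M F) f (localization M F) * g (contraction M F).

Definition vanishes_on_loops g : Prop :=
  forall M x, x \in ground M -> rk M [set x] = 0%N -> g M = 0.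

Lemma vanishes_contraction_nonflat g M A : vanishes_on_loops g ->
  A \subset ground M -> ~~ flat M A -> g (contraction M A) = 0.
Proof.
move=> g0 sA; rewrite /flat sA /= => /forallPn[x]; rewrite negb_imply -leqNgt.
case/andP=> xD l; apply: (g0 _ x); first by rewrite ground_contraction.
by rewrite rk_contraction ?sub1set //; apply/eqP; rewrite subn_eq0.
Qed.

Lemma vanishes_contraction_full_rank g M A : vanishes_on_loops g ->
  A \subset ground M -> rk M A = rank M -> A != ground M -> g (contraction M A) = 0.
Proof.
move=> g0 Ag rA; apply: contraNeq => nz; apply/eqP/flat_full_rank => //.
by apply: contraR nz => nf; rewrite vanishes_contraction_nonflat.
Qed.

Lemma flat_convolution_subsets f g M : vanishes_on_loops g ->
  flat_convolution f g M =
  \sum_(A : {set T} | A \subset ground M) f (localization M A) * g (contraction M A).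
Proof.
move=> g0; rewrite [RHS](bigID (flat M)) /= [X in _ + X]big1 ?addr0.
  by apply: eq_bigl => A; apply/esym/andb_idl; apply: flat_sub.
by move=> A /andP[Ag nf]; rewrite vanishes_contraction_nonflat ?mulr0.
Qed.

Lemma flat_convolution_uniform f g M : vanishes_on_loops g -> uniform M ->
  flat_convolution f g M =
  \sum_(A : {set T} | (A \subset ground M) && (#|A| < rank M)%N)
     f (localization M A) * g (contraction M A)
  + f M * g (contraction M (ground M)).
Proof.
move=> g0 u; rewrite flat_convolution_subsets //.
rewrite (bigID (fun A : {set T} => #|A| < rank M)%N) /=; congr (_ + _).
rewrite (bigD1 (ground M)) ?subxx -?leqNgt ?rank_le_card //= localizationT big1 ?addr0 //.
move=> A /andP[/andP[Ag]]; rewrite -leqNgt => le ne.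
by rewrite (vanishes_contraction_full_rank g0) ?mulr0 // u // (minn_idPr le).
Qed.

End FlatConvolution.

Section HalfDegree.
Implicit Types (p q R : {poly int}) (r : nat).
Local Open Scope ring_scope.

Definition half_degree r p : bool := (2 * (size p).-1 < r)%N.

Lemma halfpD r p q : halfp r (p + q) = halfp r p + halfp r q.
Proof.
rewrite /halfp -opprD; congr (- _); apply/polyP=> i.
by rewrite coefD !coef_poly coefD; case: ifP; rewrite ?addr0.
Qed.

Lemma halfp_revpB r p : half_degree r p -> halfp r (revp r p - p) = p.
Proof.
move=> dp; apply/polyP=> i; rewrite /halfp coefN coef_poly coefB coef_revp.
have lt_uphalf : (i < uphalf r)%N = (2 * i < r)%N.
  by rewrite uphalf_half; have := odd_double_half r; lia.
have coef0 j : (r <= 2 * j)%N -> p`_j = 0.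
  by move=> l; rewrite nth_default //; move: dp; rewrite /half_degree; move: (size p); lia.
rewrite lt_uphalf; case: ltnP => l; last by rewrite coef0 ?oppr0.
by rewrite ifT ?(coef0 (r - i)%N) ?sub0r ?opprK //; lia.
Qed.

Lemma revpB_inj r p q : half_degree r p -> half_degree r q ->
  revp r p - p = revp r q - q -> p = q.
Proof. by move=> dp dq e; rewrite -(halfp_revpB dp) e halfp_revpB. Qed.

Lemma eq_add_halfp r p q R : half_degree r p -> half_degree r q ->
  revp r p - revp r q = p - q + R -> p = q + halfp r R.
Proof.
move=> dp dq e; rewrite -{1}(halfp_revpB dp) -{1}(halfp_revpB dq) -halfpD; congr halfp.
by rewrite -[revp r p](subrK (revp r q)) e; ring.
Qed.

End HalfDegree.

Section KazhdanLusztig.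
Context {T : finType}.
Implicit Types (M : matroid T).
Local Open Scope ring_scope.

Lemma KL_axioms M : KL_at (@KL T) M.
Proof. exact: (forallP (@KLP T) M). Qed.

Lemma inverse_KL_axioms M : iKL_at (@inverse_KL T) M.
Proof. exact: (forallP (@inverse_KLP T) M). Qed.

Lemma half_degree_KL M : (0 < rank M)%N -> half_degree (rank M) (KL M).
Proof. by move=> r; have /and3P[_ + _] := KL_axioms M; rewrite /KL_degree r. Qed.

Lemma revp_KL M : revp (rank M) (KL M) = flat_convolution chi (@KL T) M.
Proof. by have /and3P[_ _ /eqP] := KL_axioms M. Qed.

Lemma KL_rank0E M : rank M = 0%N -> KL M = (ground M == set0)%:R.
Proof.
move=> r; have /and3P[+ _ _] := KL_axioms M.
by rewrite /KL_rank0 r /= => /eqP ->; case: eqP.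
Qed.

Lemma KL_loop : vanishes_on_loops (@KL T).
Proof.
move=> M x xg rx; have /and3P[a b /eqP c] := KL_axioms M.
rewrite -(revpK (KL_size a b)) c big1 ?linear0 // => F fF.
by rewrite (chi_localization_loop rx xg fF) mul0r.
Qed.

Lemma KL_contraction_ground M : KL (contraction M (ground M)) = 1.
Proof.
rewrite KL_rank0E ?ground_contraction ?setDv ?eqxx //.
by rewrite rank_contraction subnn.
Qed.

Lemma KL_rank1 M : rank M = 1%N -> flat M set0 -> KL M = 1.
Proof.
move=> r f0; have dM := @half_degree_KL M; have eM := revp_KL M.
rewrite r in dM eM; apply: (revpB_inj (dM isT)); first by rewrite /half_degree size_poly1.
rewrite eM /flat_convolution sum_flat_rank1 // contraction0 localizationT.
rewrite KL_contraction_ground chi_empty // chi_rank1 // mul1r mulr1 addrAC subrr add0r.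
by rewrite -[1 in RHS](expr0 'X) revpXn // expr0 expr1.
Qed.

Definition signed_inverse_KL M : {poly int} := (-1) ^+ rank M * inverse_KL M.

Definition rev_chi M : {poly int} := revp (rank M) (chi M).

Lemma half_degree_inverse_KL M : (0 < rank M)%N -> half_degree (rank M) (inverse_KL M).
Proof.
by move=> r; have /and3P[_ + _] := inverse_KL_axioms M; rewrite /KL_degree r.
Qed.

Lemma revp_inverse_KL M : revp (rank M) (inverse_KL M) =
  (-1) ^+ rank M * flat_convolution signed_inverse_KL rev_chi M.
Proof.
have /and3P[_ _ /eqP e] := inverse_KL_axioms M.
rewrite -[LHS](signrMK (rank M)) e; congr (_ * _); apply: eq_bigr => F _.
by rewrite /signed_inverse_KL /rev_chi rank_localization rank_contraction.
Qed.

Lemma inverse_KL_rank0E M : rank M = 0%N -> inverse_KL M = (ground M == set0)%:R.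
Proof.
move=> r; have /and3P[+ _ _] := inverse_KL_axioms M.
by rewrite /KL_rank0 r /= => /eqP ->; case: eqP.
Qed.

Lemma rev_chi_loop : vanishes_on_loops rev_chi.
Proof. by move=> M x xg rx; rewrite /rev_chi (chi_loop xg rx) linear0. Qed.

Lemma rev_chi_contraction_ground M : rev_chi (contraction M (ground M)) = 1.
Proof. by rewrite /rev_chi chi_contraction_ground rank_contraction subnn revp0_1. Qed.

Lemma rev_chi_rank1 M : rank M = 1%N -> flat M set0 -> rev_chi M = 1 - 'X.
Proof. by move=> r f0; rewrite /rev_chi chi_rank1 // r (revp_Xsub1_exp 1). Qed.

Lemma rev_chi_boolean M : boolean M -> rev_chi M = (1 - 'X) ^+ #|ground M|.
Proof. by move=> b; rewrite /rev_chi chi_boolean // (rank_boolean b) revp_Xsub1_exp. Qed.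

Lemma inverse_KL_boolean M : boolean M -> inverse_KL M = 1.
Proof.
have [n] := ubnP #|ground M|; elim: n M => // n IH M ltn bM.
have rM := rank_boolean bM; have [r0|rp] := posnP (rank M).
  by rewrite inverse_KL_rank0E // -cards_eq0 -rM r0.
apply: (revpB_inj (half_degree_inverse_KL rp)).
  by rewrite /half_degree size_poly1 muln0.
(* By induction, t^n Q_M(1/t) - Q_M = (-1)^n \sum_(A <> E) (-1)^|A| (1 - t)^(n - |A|). *)
rewrite revp_inverse_KL (flat_convolution_uniform _ rev_chi_loop (uniform_boolean bM)).
rewrite rev_chi_contraction_ground mulr1 /signed_inverse_KL mulrDr signrMK addrK.
rewrite -[X in revp _ X](expr0 'X) revpXn // subn0.
transitivity ((-1) ^+ rank M * \sum_(0 <= i < rank M)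
    ((-1) ^+ i * (1 - 'X) ^+ (rank M - i)) *+ 'C(#|ground M|, i) : {poly int}).
  rewrite -(sum_subsets_by_card (ground M) 0 _
    (fun i => (-1) ^+ i * (1 - 'X) ^+ (rank M - i) : {poly int})) /=.
  congr (_ * _); apply: eq_bigr => A /andP[Ag lt].
  rewrite rank_localization (rk_boolean bM Ag) IH ?mulr1 ?boolean_localization //; last 2 first.
  - by rewrite ground_localization; lia.
  - exact: indep_sub bM Ag.
  by rewrite rev_chi_boolean ?boolean_contraction // ground_contraction cardsDS // rM.
by rewrite -rM sum_signed_binomial signrMK.
Qed.

Definition inverse_KL_uniform (r n : nat) : {poly int} :=
  if r == 0%N then (n == 0%N)%:R else
  halfp r ((-1) ^+ r * \sum_(0 <= i < r)
    ((-1) ^+ i * revp (r - i) (chi_uniform (r - i) (n - i))) *+ 'C(n, i)).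

Lemma inverse_KL_uniformE M : uniform M ->
  inverse_KL M = inverse_KL_uniform (rank M) #|ground M|.
Proof.
move=> u; rewrite /inverse_KL_uniform; have [r0|rp] := posnP (rank M).
  by rewrite inverse_KL_rank0E // cards_eq0.
rewrite -[LHS](halfp_revpB (half_degree_inverse_KL rp)) revp_inverse_KL.
rewrite (flat_convolution_uniform _ rev_chi_loop u) rev_chi_contraction_ground mulr1.
rewrite {2}/signed_inverse_KL mulrDr signrMK addrK; congr (halfp _ (_ * _)).
rewrite -(sum_subsets_by_card (ground M) 0 _ (fun i =>
  (-1) ^+ i * revp (rank M - i) (chi_uniform (rank M - i) (#|ground M| - i)))) /=.
apply: eq_bigr => A /andP[Ag lt]; have iA := uniform_indep u Ag (ltnW lt).
rewrite /signed_inverse_KL inverse_KL_boolean ?boolean_localization // mulr1.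
rewrite rank_localization /rev_chi chi_uniformE; last exact: uniform_contraction.
by rewrite rank_contraction (rk_indep iA) ground_contraction cardsDS.
Qed.

End KazhdanLusztig.

Section StressedHyperplanes.
Context {T : finType}.
Implicit Types (M : matroid T) (A F H S : {set T}).

Lemma uniform_localization_stressed M H : stressed_hyperplane M H -> uniform (localization M H).
Proof.
case/andP=> /andP[_ /eqP rH] /forallP circ A AH.
rewrite rank_localization rk_localization //.
have [J [iJ JA cJ]] := rk_ex M A.
apply/eqP; rewrite eqn_leq leq_min rk_card rkS //= leqNgt; apply/negP=> lt.
have [x xA xJ] : exists2 x, x \in A & x \notin J.
  by apply/subsetPn/negP=> /subset_leq_card; lia.
(* For a basis I of H extending J, x is in I or x |: J is a proper subset of the circuit x |: I. *)
suff : indep M (x |: J).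
  move/(@indep_rk _ M _ A); rewrite subUset sub1set xA JA cardsU1 xJ => /(_ isT).
  lia.
have [I [iI JI IH cI]] := indep_ext iJ (subset_trans JA AH).
have [xI|xI] := boolP (x \in I); first by apply: indep_sub iI _; rewrite subUset sub1set xI.
have cS : #|x |: I| = rank M by rewrite cardsU1 xI cI.
have := circ (x |: I); rewrite subUset sub1set (subsetP AH x xA) IH cS eqxx.
move=> /and3P[_ _ /forallP /(_ (x |: J)) /implyP]; apply.
by rewrite properEcard setUS //= cS cardsU1 xJ cJ; lia.
Qed.

Lemma stressed_uniform_localization M H :
  hyperplane M H -> uniform (localization M H) -> stressed_hyperplane M H.
Proof.
move=> hH u; have /andP[fH /eqP rH] := hH.
have rk_sub A : A \subset H -> rk M A = minn #|A| (rk M H).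
  by move=> AH; rewrite -(rk_localization M AH) u // rank_localization.
rewrite /stressed_hyperplane hH; apply/forallP=> S; apply/implyP=> /andP[SH /eqP cS].
apply/and3P; split.
- exact: subset_trans SH (flat_sub fH).
- by rewrite indepE rk_sub // cS; lia.
apply/forallP=> I; apply/implyP=> pI.
rewrite indepE rk_sub ?(subset_trans (proper_sub pI)) //.
by have := proper_card pI; lia.
Qed.

Section Relaxation.
Variables (M : matroid T) (H : {set T}) (sH : stressed_hyperplane M H).
Let N := relaxation sH.

Lemma stressed_flat : flat M H.
Proof. by case/andP: sH => /andP[]. Qed.

Lemma stressed_sub : H \subset ground M.
Proof. exact: flat_sub stressed_flat. Qed.

Lemma rk_stressed : (rk M H).+1 = rank M.
Proof. by case/andP: sH => /andP[_ /eqP]. Qed.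

Lemma rank_stressed_gt0 : 0 < rank M.
Proof. by rewrite -rk_stressed. Qed.

Lemma rk_sub_stressed A : A \subset H -> rk M A = minn #|A| (rank M).-1.
Proof.
move=> AH; rewrite -rk_stressed -(rk_localization M AH) -(rank_localization M H).
exact: uniform_localization_stressed.
Qed.

Lemma indep_sub_stressed A : A \subset H -> #|A| < rank M -> indep M A.
Proof. by move=> AH lt; rewrite indepE rk_sub_stressed //; lia. Qed.

Lemma ground_nsub_stressed : ~~ (ground M \subset H).
Proof. by apply/negP=> /(@rkS _ M); rewrite -/(rank M) -rk_stressed ltnn. Qed.

Lemma rk_nsub_stressed A : A \subset ground M -> ~~ (A \subset H) ->
  minn #|A :&: H| (rank M).-1 < rk M A.
Proof.
move=> Ag /subsetPn[x xA xH]; rewrite -rk_sub_stressed ?subsetIr //.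
rewrite -(rk_setU1_flat stressed_flat (subsetIr _ _) (subsetP Ag _ xA) xH) rkS //.
by rewrite subUset sub1set xA subsetIl.
Qed.

Lemma flat_sub_stressed A : A \subset H -> rank M <= #|A| -> flat M A -> A = H.
Proof.
move=> AH le /flatP[_ fA]; apply/eqP; rewrite eqEsubset AH; apply/subsetP=> x xH.
apply: contraT => xA; have := fA x (subsetP stressed_sub x xH) xA.
rewrite [in X in _ < X]rk_sub_stressed ?subUset ?sub1set ?xH //.
rewrite rk_sub_stressed //; lia.
Qed.

Lemma bases_relaxation B :
  (B \in bases N) = (B \in bases M) || (B \subset H) && (#|B| == rank M).
Proof. by rewrite !inE. Qed.

Lemma ground_relaxation : ground N = ground M. Proof. by []. Qed.

Lemma rk_relaxation_nsub A : A \subset ground M -> ~~ (A \subset H) -> rk N A = rk M A.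
Proof.
move=> Ag AH; apply/eqP; rewrite eqn_leq; apply/andP; split; apply/bigmax_leqP=> B; last first.
  by move=> bB; apply: rk_ge; rewrite bases_relaxation bB.
rewrite bases_relaxation => /orP[/rk_ge //|/andP[BH /eqP cB]].
apply: leq_trans (rk_nsub_stressed Ag AH); have := subset_leq_card (subsetIl B A).
have : #|B :&: A| <= #|A :&: H|.
  by rewrite subset_leq_card // subsetI subsetIr (subset_trans (subsetIl _ _) BH).
lia.
Qed.

Lemma rank_relaxation : rank N = rank M.
Proof. by rewrite /rank rk_relaxation_nsub // ground_nsub_stressed. Qed.

Lemma rk_relaxation_sub A : A \subset H -> rk N A = minn #|A| (rank M).
Proof.
move=> AH; apply/eqP; rewrite eqn_leq; apply/andP; split.
  by rewrite leq_min rk_card -rank_relaxation rk_le_rank.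
have [lt|ge] := ltnP #|A| (rank M).
  have /indepP[B bB AB] := indep_sub_stressed AH lt.
  have bNB : B \in bases N by rewrite bases_relaxation bB.
  by have := rk_ge A bNB; rewrite (setIidPr AB); lia.
have [I [_ IA cI]] := rk_ex M A; rewrite rk_sub_stressed // in cI.
have r0 := rank_stressed_gt0.
have [x xA xI] : exists2 x, x \in A & x \notin I.
  by apply/subsetPn/negP=> /subset_leq_card; lia.
have SA : x |: I \subset A by rewrite subUset sub1set xA.
have cS : #|x |: I| = rank M by rewrite cardsU1 xI; lia.
have bS : x |: I \in bases N by rewrite bases_relaxation cS eqxx (subset_trans SA AH) orbT.
by have := rk_ge A bS; rewrite (setIidPl SA) cS.
Qed.

Lemma contraction_relaxation_nsub F : F \subset ground M -> ~~ (F \subset H) ->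
  contraction N F = contraction M F.
Proof.
move=> Fg FH; apply: eq_matroid_rk => // A sA.
have AFg : A :|: F \subset ground M.
  by rewrite subUset Fg (subset_trans sA) // subsetDl.
rewrite !rk_contraction // !rk_relaxation_nsub //.
by apply: contra FH; apply: subset_trans (subsetUr _ _).
Qed.

Lemma localization_relaxation F : F \subset ground M -> rk N F < rank M ->
  localization N F = localization M F.
Proof.
move=> Fg lt; apply: eq_matroid_rk => // A AF; rewrite ground_localization in AF.
rewrite !rk_localization //; have [AH|AH] := boolP (A \subset H); last first.
  by rewrite rk_relaxation_nsub // (subset_trans AF Fg).
have := rkS N AF; rewrite rk_relaxation_sub // rk_sub_stressed //; lia.
Qed.

Lemma stressed_contraction F : F \subset H -> #|F| < rank M ->
  stressed_hyperplane (contraction M F) (H :\: F).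
Proof.
move=> FH lt; have Hg := stressed_sub; have Fg := subset_trans FH Hg.
have DF : H :\: F :|: F = H by rewrite -[RHS](setID H F) (setIidPr FH) setUC.
apply: stressed_uniform_localization.
  apply/andP; split; first by rewrite flat_contraction ?setSD // DF stressed_flat.
  rewrite rk_contraction ?setSD // DF rank_contraction -rk_stressed subSn //.
  exact: rkS.
rewrite localization_contraction //; apply: uniform_contraction => //.
exact: uniform_localization_stressed.
Qed.

Lemma rank_contraction_stressed F : F \subset H -> #|F| < rank M ->
  rank (contraction M F) = rank M - #|F|.
Proof. by move=> FH lt; rewrite rank_contraction (rk_indep (indep_sub_stressed FH lt)). Qed.

Lemma rank_contraction_hyperplane : rank (contraction M H) = 1.
Proof. by rewrite rank_contraction -rk_stressed subSnn. Qed.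

End Relaxation.

Lemma contraction_relaxation_sub M H (sH : stressed_hyperplane M H) F
    (FH : F \subset H) (lt : #|F| < rank M) :
  contraction (relaxation sH) F = relaxation (stressed_contraction sH FH lt).
Proof.
have Fg := subset_trans FH (stressed_sub sH).
have rF := rk_indep (indep_sub_stressed sH FH lt).
apply: eq_matroid_rk => // A sA; rewrite rk_contraction // (rk_relaxation_sub sH FH).
have := sA; rewrite subsetD => /andP[Ag d].
have AFH : (A :|: F \subset H) = (A \subset H :\: F) by rewrite subUset FH andbT subsetD d andbT.
have [AH|AH] := boolP (A \subset H :\: F).
  rewrite !rk_relaxation_sub ?AFH // (rank_contraction_stressed sH FH lt).
  by rewrite cardsU (disjoint_setI0 d) cards0; lia.
rewrite !rk_relaxation_nsub ?AFH // ?subUset ?Ag ?Fg // rk_contraction // rF.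
by congr (_ - _); lia.
Qed.

End StressedHyperplanes.

Section RelaxationConvolution.
Context {T : finType}.
Implicit Types (A : {set T}).
Local Open Scope ring_scope.
Variables (R : pzRingType) (f g : matroid T -> R).
Variables (M : matroid T) (H : {set T}) (sH : stressed_hyperplane M H).
Hypothesis g_loop : vanishes_on_loops g.
Let N := relaxation sH.
Let term_gain A : R :=
  f (localization N A) * g (contraction N A) - f (localization M A) * g (contraction M A).

Lemma sum_term_gain_large_sub :
  \sum_(A : {set T} | (A \subset H) && ~~ (#|A| < rank M)%N) term_gain A
  = - (f (localization M H) * g (contraction M H) *+ (rank M <= #|H|)).
Proof.
have Hg := stressed_sub sH.
have gN A : A \subset H -> (rank M <= #|A|)%N -> g (contraction N A) = 0.
  move=> AH le; apply: vanishes_contraction_full_rank => //.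
  - exact: subset_trans Hg.
  - by rewrite rk_relaxation_sub // rank_relaxation (minn_idPr le).
  by apply: contraNneq (ground_nsub_stressed sH) => eA; rewrite -(ground_relaxation sH) -eA.
have gM A : A \subset H -> (rank M <= #|A|)%N -> A != H -> g (contraction M A) = 0.
  move=> AH le; apply: contraNeq => nz; apply/eqP/(flat_sub_stressed sH) => //.
  apply: contraR nz => nf; rewrite (vanishes_contraction_nonflat g_loop) //.
  exact: subset_trans Hg.
have [le|gt] := leqP (rank M) #|H|; last first.
  rewrite big1 ?oppr0 // => A /andP[/subset_leq_card AH]; lia.
rewrite (bigD1 H) ?subxx -?leqNgt //= /term_gain gN // mulr0 sub0r big1 ?addr0 //.
by move=> A /andP[/andP[AH]]; rewrite -leqNgt => leA ne; rewrite gN // gM // !mulr0 subrr.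
Qed.

Lemma sum_term_gain_nsub :
  \sum_(A : {set T} | (A \subset ground M) && ~~ (A \subset H)) term_gain A
  = (f N - f M) * g (contraction M (ground M)).
Proof.
have nH := ground_nsub_stressed sH.
rewrite (bigD1 (ground M)) ?subxx //= /term_gain.
rewrite contraction_relaxation_nsub // localizationT.
rewrite -{1}(ground_relaxation sH) localizationT mulrBl big1 ?addr0 // => A.
move=> /andP[/andP[Ag AH] ne]; rewrite contraction_relaxation_nsub //.
have [lt|ge] := ltnP (rk M A) (rank M).
  by rewrite localization_relaxation ?subrr // rk_relaxation_nsub.
rewrite (vanishes_contraction_full_rank g_loop) ?mulr0 ?subrr //.
by apply/eqP; rewrite eqn_leq ge rk_le_rank.
Qed.

Lemma flat_convolution_relaxation :
  flat_convolution f g N - flat_convolution f g M =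
  \sum_(A : {set T} | (A \subset H) && (#|A| < rank M)%N)
     f (localization M A) * (g (contraction N A) - g (contraction M A))
  - f (localization M H) * g (contraction M H) *+ (rank M <= #|H|)
  + (f N - f M) * g (contraction M (ground M)).
Proof.
rewrite !flat_convolution_subsets // ground_relaxation -sumrB.
rewrite (bigID (fun A : {set T} => A \subset H)) /= sum_term_gain_nsub; congr (_ + _).
rewrite (eq_bigl (fun A : {set T} => A \subset H)) => [|A]; last first.
  by apply: andb_idl => AH; apply: subset_trans (stressed_sub sH).
rewrite (bigID (fun A : {set T} => #|A| < rank M)%N) /= sum_term_gain_large_sub; congr (_ + _).
apply: eq_bigr => A /andP[AH lt]; rewrite localization_relaxation ?mulrBr //.
  exact: subset_trans (stressed_sub sH).
by rewrite rk_relaxation_sub // (minn_idPl (ltnW lt)).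
Qed.

End RelaxationConvolution.

Section RelaxationGains.
Local Open Scope ring_scope.
Context {T : finType}.
Implicit Types (M : matroid T) (A H : {set T}).

Lemma KL_contraction_stressed M H : stressed_hyperplane M H -> KL (contraction M H) = 1.
Proof.
move=> sH; rewrite KL_rank1 ?flat0_contraction ?stressed_flat //.
exact: rank_contraction_hyperplane.
Qed.

Lemma rev_chi_contraction_stressed M H :
  stressed_hyperplane M H -> rev_chi (contraction M H) = 1 - 'X.
Proof.
move=> sH; rewrite rev_chi_rank1 ?flat0_contraction ?stressed_flat //.
exact: rank_contraction_hyperplane.
Qed.

Definition chi_gain (k h : nat) : {poly int} :=
  (1 - 'X) * \sum_(k <= i < h.+1) (-1) ^+ i *+ 'C(h, i).

Lemma chi_relaxation M H (sH : stressed_hyperplane M H) :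
  chi (relaxation sH) = chi M + chi_gain (rank M) #|H|.
Proof.
have rH := rk_stressed sH.
apply/eqP; rewrite addrC -subr_eq /chi rank_relaxation ground_relaxation -sumrB.
rewrite (bigID (fun A : {set T} => (A \subset H) && (rank M <= #|A|)%N)) /=.
rewrite [X in _ + X]big1 ?addr0 => [|A /andP[Ag]]; last first.
  have [AH /= lt|AH _] := boolP (A \subset H); last by rewrite rk_relaxation_nsub // subrr.
  rewrite rk_relaxation_sub // (rk_sub_stressed sH) //.
  have -> : minn #|A| (rank M) = minn #|A| (rank M).-1 by lia.
  by rewrite subrr.
rewrite /chi_gain -(sum_subsets_by_card H (rank M) _ (fun i => (-1) ^+ i)) mulr_sumr.
apply/eqP/eq_big => [A|A /andP[Ag /andP[AH le]]].
  rewrite ltnS; case: (boolP (A \subset H)) => [AH|]; rewrite ?andbF //=.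
  by rewrite (subset_trans AH (stressed_sub sH)) subset_leq_card // andbT.
rewrite rk_relaxation_sub // (rk_sub_stressed sH) // -mulrBr mulrC; congr (_ * _).
have -> : (rank M - minn #|A| (rank M) = 0)%N by lia.
by have -> : (rank M - minn #|A| (rank M).-1 = 1)%N by lia.
Qed.

Lemma rev_chi_relaxation M H (sH : stressed_hyperplane M H) :
  rev_chi (relaxation sH) = rev_chi M + revp (rank M) (chi_gain (rank M) #|H|).
Proof. by rewrite /rev_chi chi_relaxation rank_relaxation linearD. Qed.

(* For [0 < i], [k' - i.-1] is [k - i] in a form that the guard condition accepts. *)
Fixpoint KL_gain (k h : nat) : {poly int} :=
  if k is k'.+1 then
    halfp k (\sum_(1 <= i < k) (('X - 1) ^+ i * KL_gain (k' - i.-1) (h - i)) *+ 'C(h, i)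
             - chi_uniform k' h *+ (k <= h) + chi_gain k h)
  else 0.

Lemma KL_gainE k h : (0 < k)%N -> KL_gain k h =
  halfp k (\sum_(1 <= i < k) (('X - 1) ^+ i * KL_gain (k - i) (h - i)) *+ 'C(h, i)
           - chi_uniform k.-1 h *+ (k <= h) + chi_gain k h).
Proof.
case: k => // k _ /=; congr (halfp _ (_ - _ + _)); by apply: eq_big_nat => -[|i].
Qed.

Lemma KL_relaxation M H (sH : stressed_hyperplane M H) :
  KL (relaxation sH) = KL M + KL_gain (rank M) #|H|.
Proof.
have [n] := ubnP (rank M); elim: n M H sH => // n IH M H sH ltn.
set N := relaxation sH; have rN : rank N = rank M := rank_relaxation sH.
have r0 := rank_stressed_gt0 sH; rewrite KL_gainE //.
apply: eq_add_halfp; [by rewrite -rN half_degree_KL ?rN|exact: half_degree_KL|].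
rewrite -{1}rN !revp_KL (flat_convolution_relaxation _ sH KL_loop) KL_contraction_ground.
rewrite mulr1 chi_relaxation [chi M + _ - _]addrAC subrr add0r !addrA.
congr (_ - _ *+ _ + _); last first.
  rewrite KL_contraction_stressed // mulr1 chi_uniformE; last exact: uniform_localization_stressed.
  by rewrite rank_localization -(rk_stressed sH).
rewrite (bigD1 set0) /=; last by rewrite sub0set cards0.
rewrite !contraction0 chi_empty // mul1r; congr (_ + _).
rewrite -(sum_subsets_by_card H 1 _
  (fun i => ('X - 1) ^+ i * KL_gain (rank M - i) (#|H| - i))).
apply: eq_big => [A|A /andP[/andP[AH lt] ne]].
  by rewrite -card_gt0 -andbA [(_ < _)%N && _]andbC.
have A0 : (0 < #|A|)%N by rewrite card_gt0.
rewrite chi_boolean; last by rewrite boolean_localization ?(indep_sub_stressed sH).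
rewrite (contraction_relaxation_sub sH AH lt) IH (rank_contraction_stressed sH) //; last lia.
by rewrite cardsDS // addrAC subrr add0r.
Qed.

Lemma KL_contraction_relaxation M H (sH : stressed_hyperplane M H) A :
  A \subset H -> (#|A| < rank M)%N ->
  KL (contraction (relaxation sH) A) - KL (contraction M A) =
  KL_gain (rank M - #|A|) (#|H| - #|A|).
Proof.
move=> AH lt; rewrite (contraction_relaxation_sub sH AH lt) KL_relaxation.
by rewrite (rank_contraction_stressed sH) // cardsDS // addrAC subrr add0r.
Qed.

Definition Zpoly_gain (k h : nat) : {poly int} :=
  \sum_(0 <= i < k) ('X^i * KL_gain (k - i) (h - i)) *+ 'C(h, i) - 'X^(k.-1) *+ (k <= h).

Lemma Zpoly_flat_convolution M :
  Zpoly M = flat_convolution (fun L => 'X^(rank L)) (@KL T) M.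
Proof. by apply: eq_bigr => F _; rewrite rank_localization. Qed.

Lemma Zpoly_relaxation M H (sH : stressed_hyperplane M H) :
  Zpoly (relaxation sH) = Zpoly M + Zpoly_gain (rank M) #|H|.
Proof.
apply/eqP; rewrite addrC -subr_eq !Zpoly_flat_convolution; apply/eqP.
rewrite (flat_convolution_relaxation _ sH KL_loop) rank_relaxation subrr mul0r addr0.
rewrite KL_contraction_stressed // mulr1 rank_localization -(rk_stressed sH) /=.
congr (_ - _); rewrite (rk_stressed sH).
rewrite -(sum_subsets_by_card H 0 _ (fun i => 'X^i * KL_gain (rank M - i) (#|H| - i))).
apply: eq_bigr => A /andP[AH lt]; rewrite KL_contraction_relaxation //.
by rewrite rank_localization (rk_indep (indep_sub_stressed sH AH lt)).
Qed.

Definition inverse_KL_gain (k h : nat) : {poly int} :=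
  halfp k ((-1) ^+ k *
    (\sum_(0 <= i < k) ((-1) ^+ i * revp (k - i) (chi_gain (k - i) (h - i))) *+ 'C(h, i)
     - ((-1) ^+ k.-1 * inverse_KL_uniform k.-1 h * (1 - 'X)) *+ (k <= h))).

Lemma inverse_KL_relaxation M H (sH : stressed_hyperplane M H) :
  inverse_KL (relaxation sH) = inverse_KL M + inverse_KL_gain (rank M) #|H|.
Proof.
set N := relaxation sH; have rN : rank N = rank M := rank_relaxation sH.
have r0 := rank_stressed_gt0 sH.
apply: eq_add_halfp;
  [by rewrite -rN half_degree_inverse_KL ?rN|exact: half_degree_inverse_KL|].
rewrite -{1}rN !revp_inverse_KL rN -mulrBr.
rewrite (flat_convolution_relaxation _ sH rev_chi_loop) rev_chi_contraction_ground mulr1.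
rewrite {3 4}/signed_inverse_KL rN -mulrBr mulrDr signrMK addrC; congr (_ + _ * (_ - _ *+ _)).
  rewrite -(sum_subsets_by_card H 0 _
    (fun i => (-1) ^+ i * revp (rank M - i) (chi_gain (rank M - i) (#|H| - i)))).
  apply: eq_bigr => A /andP[AH lt]; have iA := indep_sub_stressed sH AH lt.
  rewrite (contraction_relaxation_sub sH AH lt) rev_chi_relaxation addrAC subrr add0r.
  rewrite (rank_contraction_stressed sH) // cardsDS // /signed_inverse_KL.
  rewrite inverse_KL_boolean ?boolean_localization // mulr1 rank_localization.
  by rewrite (rk_indep iA).
rewrite rev_chi_contraction_stressed // /signed_inverse_KL inverse_KL_uniformE.
  by rewrite rank_localization -(rk_stressed sH).
exact: uniform_localization_stressed.
Qed.

End RelaxationGains.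

Theorem theorem4p1 (k h : nat) (k_ge1 : 1 <= k) (h_ge1 : 1 <= h) :
  exists p q z : {poly int},
  forall (T : finType) (M : matroid T) (H : {set T})
         (sH : stressed_hyperplane M H),
  rank M = k -> #|H| = h ->
  [/\ KL (relaxation sH) = (KL M + p)%R,
      inverse_KL (relaxation sH) = (inverse_KL M + q)%R
    & Zpoly (relaxation sH) = (Zpoly M + z)%R].
Proof.
exists (KL_gain k h), (inverse_KL_gain k h), (Zpoly_gain k h) => T M H sH <- <-.
by rewrite KL_relaxation inverse_KL_relaxation Zpoly_relaxation.
Qed.
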